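(* Let $C_t$ be the cycle on $t$ vertices, $t>3$. Then, for an integer $n$, $$\mathcal{GM}(C_t)\simeq\begin{cases}\mathbb{S}^{2n-1}\vee\mathbb{S}^{2n-1} & \text{if } t=3n,\\ \mathbb{S}^{2n} & \text{if } t=3n+1,\\ \mathbb{S}^{2n} & \text{if } t=3n+2.\end{cases}$$
   Context: $C_t$ is the simplicial complex with facets $\{v_0,v_1\},\{v_1,v_2\},\ldots,\{v_{t-2},v_{t-1}\},\{v_{t-1},v_0\}$. For a finite simplicial complex $K$, a discrete vector field on $K$ is a set of pairs $(\sigma^{(p)},\tau^{(p+1)})$ of simplices of $K$ with $\sigma$ a codimension-one face of $\tau$ (superscripts denote dimension), such that each simplex of $K$ is in at most one pair. The generalized Morse complex $\mathcal{GM}(K)$ is the simplicial complex whose vertices are the single such pairs $(\sigma,\tau)$ (primitive gradient vector fields) and whose simplices are the nonempty discrete vector fields on $K$, with face relation given by inclusion. *)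

(* Defs.v *)
From HB Require Import structures.
From mathcomp Require Import all_boot all_order all_algebra.
From mathcomp Require Import all_classical all_reals.
From mathcomp Require Import topology normedtype homotopy.

Set Implicit Arguments.
Unset Strict Implicit.
Unset Printing Implicit Defensive.

Import Order.TTheory GRing.Theory Num.Theory.
Import numFieldNormedType.Exports.

Local Open Scope classical_set_scope.
Local Open Scope ring_scope.

(* A vertex of the complex is a [v : V] such that [[set v]] is a simplex;
   elements of [V] that are not vertices are allowed. *)
Record scomplex (V : finType) := SComplex {
  simplices :> {set {set V}};
  simplex_neq0 : forall s, s \in simplices -> s != finset.set0;
  simplex_sub : forall s u : {set V},
    u \in simplices -> s \subset u -> s != finset.set0 -> s \in simplices
}.

Section GeneratedComplex.
Variables (V : finType) (F : {set {set V}}).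

Definition generated_simplices : {set {set V}} :=
  [set s : {set V} | (s != finset.set0) && [exists u in F, s \subset u]]%SET.

Fact generated_neq0 s : s \in generated_simplices -> s != finset.set0.
Proof. by rewrite inE => /andP[]. Qed.

Fact generated_sub (s u : {set V}) : u \in generated_simplices ->
  s \subset u -> s != finset.set0 -> s \in generated_simplices.
Proof.
rewrite !inE => /andP[_ /exists_inP[w wF uw]] su -> /=.
by apply/exists_inP; exists w => //; apply: fintype.subset_trans uw.
Qed.

Definition generated_complex : scomplex V :=
  SComplex generated_neq0 generated_sub.

End GeneratedComplex.

(* [ordS i] is [i + 1] modulo [t]. *)
Definition cycle_complex (t : nat) : scomplex 'I_t :=
  generated_complex [set [set i; ordS i]%SET | i : 'I_t]%SET.

Definition sdim (V : finType) (s : {set V}) : nat := #|s|.-1.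

Section GeneralizedMorseComplex.
Variables (V : finType) (K : scomplex V).
Local Notation pair := ({set V} * {set V})%type.

Definition primitive_vector (p : pair) : bool :=
  [&& p.1 \in simplices K, p.2 \in simplices K, p.1 \subset p.2
    & sdim p.2 == (sdim p.1).+1].

Definition discrete_vector_field (W : {set pair}) : bool :=
  [forall p in W, primitive_vector p] &&
  [forall s in simplices K,
     #|[set p in W | (p.1 == s) || (p.2 == s)]%SET| <= 1]%N.

Definition morse_simplices : {set {set pair}} :=
  [set W : {set pair} | (W != finset.set0) && discrete_vector_field W]%SET.

Fact morse_neq0 W : W \in morse_simplices -> W != finset.set0.
Proof. by rewrite inE => /andP[]. Qed.

Fact morse_sub (W U : {set pair}) : U \in morse_simplices ->
  W \subset U -> W != finset.set0 -> W \in morse_simplices.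
Proof.
rewrite !inE => /and3P[_ /forall_inP pU /forall_inP mU] WU -> /=.
apply/andP; split; apply/forall_inP.
  by move=> p pW; apply: pU; apply: (fintype.subsetP WU).
move=> s sK; apply: leq_trans (mU s sK); apply: subset_leq_card.
by apply/fintype.subsetP => p; rewrite !inE => /andP[/(fintype.subsetP WU) -> ->].
Qed.

Definition generalized_morse_complex : scomplex pair :=
  SComplex morse_neq0 morse_sub.

End GeneralizedMorseComplex.

(* Barycentric coordinates; [V] being finite, the topology of pointwise
   convergence on [V -> R] is the Euclidean one. *)
Definition realization_set (R : realType) (V : finType) (K : scomplex V) :
    set {ptws V -> R} :=
  [set x | [/\ forall v, 0 <= x v, \sum_v x v = 1
             & [set v | x v != 0]%SET \in simplices K]].

Arguments realization_set : clear implicits.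
Arguments realization_set R {V} K.

Definition realization (R : realType) (V : finType) (K : scomplex V) :
  topologicalType := set_type (realization_set R K).

(* The norm [`|x|] on ['rV[R]_n] is the sup norm, hence the explicit sum. *)
Definition sphere_set (R : realType) (k : nat) : set 'rV[R]_k.+1 :=
  [set x | \sum_i x ord0 i ^+ 2 = 1].

Arguments sphere_set : clear implicits.

Definition sphere (R : realType) (k : nat) : Type := set_type (sphere_set R k).

HB.instance Definition _ R k := Topological.on (sphere R k).

Fact sphere_base_subproof (R : realType) (k : nat) :
  (delta_mx ord0 ord0 : 'rV[R]_k.+1) \in sphere_set R k.
Proof.
apply/mem_set; rewrite /sphere_set /= (bigD1 ord0)//= mxE !eqxx expr1n.
by rewrite big1 ?addr0// => i i0; rewrite mxE (negbTE i0) andbF expr0n.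
Qed.

Definition sphere_base (R : realType) (k : nat) : sphere R k :=
  SigSub (sphere_base_subproof R k).

HB.instance Definition _ R k :=
  isPointed.Build (sphere R k) (sphere_base R k).

Definition wedge2 (X Y : ptopologicalType) : topologicalType :=
  pwedge (fun b : bool => if b then X else Y).

(* Only the values of [H] on [`[0, 1] `*` X] matter. *)
Definition homotopic (R : realType) (X Y : topologicalType) (f g : X -> Y) :=
  exists H : R * X -> Y,
    [/\ {within `[0, 1] `*` [set: X], continuous H},
        forall x, H (0, x) = f x & forall x, H (1, x) = g x].

Definition homotopy_equivalent (R : realType) (X Y : topologicalType) :=
  exists (f : X -> Y) (g : Y -> X),
    [/\ continuous f, continuous g,
        homotopic R (g \o f) idfun & homotopic R (f \o g) idfun].

(* Main.v *)
Require Import Defs.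
From mathcomp Require Import all_boot all_order all_algebra.
From mathcomp Require Import all_classical all_reals.
From mathcomp Require Import topology normedtype homotopy.
From mathcomp Require Import realfun lra zify.

(** A discrete vector field on the cycle of length [t] is a matching of its
    Hasse diagram, which is a cycle of length [2 * t]. The edges of this diagram
    also form a cycle of length [2 * t] under the relation of sharing an end, so
    the generalized Morse complex is the complex of independent sets of a cycle
    of length [N = 2 * t] ([morse_cycle_stage]).

    Independence complexes are flag complexes, and one move is used to change
    them ([flag_del_edge]): if every simplex containing [u] and [v] can be
    enlarged by a vertex [a], then deleting all simplices that contain [u] and
    [v] does not change the homotopy type, since the weight of [u] and [v] can
    be pushed towards [a]. In terms of graphs, an edge [uv] may be added or
    removed when all neighbours of some vertex [a] are neighbours of [u] or of
    [v]. Three such moves turn the cycle of length [m + 3] into the disjoint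
    union of a cycle of length [m] and a path of three vertices ([stage_step]).
    The independence complex of that path is equivalent to two points, and a
    disjoint union of graphs is a join of complexes; thus every step is a
    suspension.

    Iterating the step leaves [m = 1], [2] or [3], with the same residue as [N]
    modulo 3. For [m = 1] the cycle is a loop and has no independent vertex; for
    [m = 2] it is an edge and contributes one more pair of opposite vertices. In
    both cases the result is the boundary of a cross-polytope ([stage_cross]),
    which is a sphere ([cross_sphere]).

    For [m = 3], that is when 3 divides [t], the result is the join of three
    points [p], [q], [r] with the boundary of a cross-polytope. Doubling the
    vertices of this boundary and then deleting edges with the same move
    separates it into the join of [{p, q}] with one copy and the join of
    [{q, r}] with the other ([stage_doubled], [doubled_sided], [sided_glued]).
    These are two boundaries of cross-polytopes that share the vertex [q] only,
    hence a wedge of two spheres ([glued_wedge]). *)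

Set Implicit Arguments.
Unset Strict Implicit.
Unset Printing Implicit Defensive.

Import Order.TTheory GRing.Theory Num.Theory.
Import numFieldNormedType.Exports.

Local Open Scope classical_set_scope.
Local Open Scope ring_scope.

(** * Continuity *)

Lemma continuous_set_type (X Y : topologicalType) (A : set Y)
    (f : X -> set_type A) :
  continuous (fun x => set_val (f x)) -> continuous f.
Proof.
move=> cf; apply/continuousP => _ [B oB <-].
by have /continuousP := cf; apply.
Qed.

Lemma set_val_continuous (Y : topologicalType) (A : set Y) :
  continuous (set_val : set_type A -> Y).
Proof. exact: initial_continuous. Qed.

Lemma continuous_ptws (V : finType) (X Y : topologicalType)
    (f : X -> {ptws V -> Y}) :
  (forall v, continuous (fun x => f x v)) -> continuous f.
Proof.
move=> cf x; apply/cvg_sup => v; apply/cvg_image => //.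
  by rewrite eqEsubset; split => // y _; exists (fun=> y).
move=> A /(cf v x) FA.
exists (fun g : V -> Y => A (g v)) => //.
rewrite eqEsubset; split => [_ [g Ag <-]//|y Ay].
by exists (fun=> y).
Qed.

Lemma eval_ptws_continuous (V : finType) (Y : topologicalType) (v : V) :
  continuous (fun f : {ptws V -> Y} => f v).
Proof. exact: (@proj_continuous V (fun=> Y) v). Qed.

Lemma continuous_pair (X Y Z : topologicalType) (f : X -> Y) (g : X -> Z) :
  continuous f -> continuous g -> continuous (fun x => (f x, g x)).
Proof. by move=> cf cg x; apply: cvg_pair; [exact: cf|exact: cg]. Qed.

Lemma continuous_funcomp (X Y Z : topologicalType) (f : X -> Y) (g : Y -> Z) :
  continuous f -> continuous g -> continuous (g \o f).
Proof. by move=> cf cg x; apply: continuous_comp; [exact: cf|exact: cg]. Qed.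

Section RealFunctions.
Variables (R : realType) (X : topologicalType).
Implicit Types f g : X -> R.

Lemma continuous_cst (c : R) : continuous (fun _ : X => c).
Proof. exact: cst_continuous. Qed.

Lemma continuous_add f g :
  continuous f -> continuous g -> continuous (fun x => f x + g x).
Proof. by move=> cf cg x; apply: (@cvgD R R^o); [exact: cf|exact: cg]. Qed.

Lemma continuous_sub f g :
  continuous f -> continuous g -> continuous (fun x => f x - g x).
Proof. by move=> cf cg x; apply: (@cvgB R R^o); [exact: cf|exact: cg]. Qed.

Lemma continuous_mul f g :
  continuous f -> continuous g -> continuous (fun x => f x * g x).
Proof. by move=> cf cg x; apply: cvgM; [exact: cf|exact: cg]. Qed.

Lemma continuous_inv f : (forall x, f x != 0) ->
  continuous f -> continuous (fun x => (f x)^-1).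
Proof. by move=> f0 cf x; apply: cvgV; [exact: f0|exact: cf]. Qed.

Lemma continuous_norm f : continuous f -> continuous (fun x => `|f x|).
Proof. by move=> cf x; apply: (@cvg_norm R R^o); exact: cf. Qed.

Lemma continuous_sqrt f : continuous f -> continuous (fun x => Num.sqrt (f x)).
Proof.
by move=> cf; apply: (continuous_funcomp cf); exact: sqrt_continuous.
Qed.

Lemma continuous_minr f g :
  continuous f -> continuous g -> continuous (fun x => Num.min (f x) (g x)).
Proof. by move=> cf cg x; apply: continuous_min; [exact: cf|exact: cg]. Qed.

Lemma continuous_maxr f g :
  continuous f -> continuous g -> continuous (fun x => Num.max (f x) (g x)).
Proof. by move=> cf cg x; apply: continuous_max; [exact: cf|exact: cg]. Qed.

Lemma continuous_sumr (I : finType) (P : pred I) (f : I -> X -> R) :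
  (forall i, continuous (f i)) -> continuous (fun x => \sum_(i | P i) f i x).
Proof.
by move=> cf; apply: (@continuous_big R^o I _ 0 P) => //; exact: add_continuous.
Qed.

End RealFunctions.

(** * Homotopies and homotopy equivalences *)

(** The pasting lemma in a form that asks for no restriction of domains. *)
Lemma continuous_closed_cover (X Y : topologicalType) (A B : set X)
    (f g h : X -> Y) :
  closed A -> closed B -> (forall x, A x \/ B x) ->
  continuous f -> continuous g ->
  (forall x, A x -> h x = f x) -> (forall x, B x -> h x = g x) ->
  continuous h.
Proof.
move=> clA clB AB cf cg hf hg; apply/continuous_subspace_setT.
have -> : [set: X] = A `|` B by rewrite eqEsubset; split => // x _; exact: AB.
have eqc (C : set X) (k : X -> Y) : continuous k ->
    (forall x, C x -> h x = k x) -> {within C, continuous h}.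
  move=> /(@continuous_subspaceT _ _ C) ck hk.
  apply: (subspace_eq_continuous _ ck) => x; rewrite inE => Cx.
  by rewrite /from_subspace/= hk.
by apply: withinU_continuous => //; [exact: eqc hf|exact: eqc hg].
Qed.

Section Homotopy.
Variable R : realType.

Definition clamp (s : R) : R := Num.max 0 (Num.min 1 s).

Lemma clamp_itv s : 0 <= clamp s <= 1.
Proof. by rewrite /clamp le_max lexx ge_max ler01 ge_min lexx. Qed.

Lemma clamp_id s : 0 <= s <= 1 -> clamp s = s.
Proof. by move=> /andP[s0 s1]; rewrite /clamp min_r// max_r. Qed.

Lemma clamp_continuous : continuous clamp.
Proof.
move=> s; apply: (@continuous_max R R (cst 0) (fun x => Num.min 1 x)).
  exact: cst_continuous.
apply: (@continuous_min R R (cst 1) id); first exact: cst_continuous.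
exact: cvg_id.
Qed.

(** Precomposing with the retraction of the line onto the unit interval turns a
    homotopy that is continuous only over the interval into one that is
    continuous everywhere, so that the usual constructions on homotopies need
    no care about subspaces. *)
Lemma homotopicP (X Y : topologicalType) (f g : X -> Y) :
  homotopic R f g <-> exists H : R * X -> Y,
    [/\ continuous H, forall x, H (0, x) = f x & forall x, H (1, x) = g x].
Proof.
split=> [[H [cH H0 H1]]|[H [cH H0 H1]]]; last first.
  by exists H; split => //; exact: continuous_subspaceT.
exists (fun p => H (clamp p.1, p.2)); split => [|x|x] /=; last 2 first.
- by rewrite clamp_id ?lexx ?ler01.
- by rewrite clamp_id ?lexx ?ler01.
have cc : continuous (fun p : R * X => (clamp p.1, p.2)).
  apply: continuous_pair => p; last exact: cvg_snd.
  apply: (@continuous_comp _ _ _ fst clamp); first exact: cvg_fst.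
  exact: clamp_continuous.
move=> p; apply: (@cvg_comp _ _ _ (fun p : R * X => (clamp p.1, p.2)) H _
  (within (`[0, 1] `*` [set: X]) (nbhs (clamp p.1, p.2)))).
  move=> A AW; have : nbhs p (fun q : R * X => (`[0, 1] `*` [set: X])
    (clamp q.1, q.2) -> A (clamp q.1, q.2)) := cc p _ AW.
  by apply: filterS => q; apply; split => //=; rewrite in_itv; exact: clamp_itv.
have/subspace_continuousP := cH; apply.
by split => //=; rewrite in_itv; exact: clamp_itv.
Qed.

Lemma homotopic_refl (X Y : topologicalType) (f : X -> Y) :
  continuous f -> homotopic R f f.
Proof.
move=> cf; apply/homotopicP; exists (fun p => f p.2); split => //.
by move=> p; apply: (@continuous_comp _ _ _ snd f); [exact: cvg_snd|exact: cf].
Qed.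

Lemma homotopic_trans (X Y : topologicalType) (f g h : X -> Y) :
  homotopic R f g -> homotopic R g h -> homotopic R f h.
Proof.
move=> /homotopicP[H [cH H0 H1]] /homotopicP[K [cK K0 K1]].
have caff (k : R) : continuous (fun s : R => 2 * s - k).
  move=> s; apply: (@continuousB R R^o R); last exact: cst_continuous.
  by apply: continuousM; [exact: cst_continuous|exact: cvg_id].
have cpart (L : R * X -> Y) k : continuous L ->
    continuous (fun p : R * X => L (2 * p.1 - k, p.2)).
  move=> cL; apply: (@continuous_funcomp _ _ _ (fun p : R * X => (2 * p.1 - k, p.2)) L) => //.
  apply: continuous_pair; last by move=> p; exact: cvg_snd.
  apply: (@continuous_funcomp _ _ _ fst (fun s : R => 2 * s - k)) => //.
  by move=> p; exact: cvg_fst.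
exists (fun p => if p.1 <= 2^-1 then H (2 * p.1 - 0, p.2) else K (2 * p.1 - 1, p.2)).
split => [|x|x] /=; last 2 first.
- by rewrite invr_ge0 ler0n mulr0 subr0.
- rewrite ifF; last by apply/negbTE; rewrite -ltNge invf_lt1 ?ltr1n // ltr0n.
  by rewrite mulr1 [2 - 1](_ : _ = 1) ?K1 //; lra.
apply: continuous_subspaceT.
apply: (@continuous_closed_cover _ _ (fst @^-1` [set x : R | x <= 2^-1])
  (fst @^-1` [set x : R | 2^-1 <= x])
  (fun p => H (2 * p.1 - 0, p.2)) (fun p => K (2 * p.1 - 1, p.2))).
- by apply: closed_comp; [move=> ? _; exact: cvg_fst|exact: closed_le].
- by apply: closed_comp; [move=> ? _; exact: cvg_fst|exact: closed_ge].
- by move=> p /=; case: (leP p.1 2^-1); [left|move=>/ltW; right].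
- exact: cpart.
- exact: cpart.
- by move=> p /= ->.
- move=> [s x] /= s2; case: ifPn => // s2'.
  have -> : s = 2^-1 by apply/eqP; rewrite eq_le s2 s2'.
  by rewrite mulfV ?pnatr_eq0// subr0 subrr K0 H1.
Qed.

Lemma homotopic_comp (X Y Z W : topologicalType) (k : X -> Y) (f g : Y -> Z) (h : Z -> W) :
  continuous k -> continuous h -> homotopic R f g ->
  homotopic R (h \o f \o k) (h \o g \o k).
Proof.
move=> ck ch /homotopicP[H [cH H0 H1]]; apply/homotopicP.
exists (fun p => h (H (p.1, k p.2))); split => [|x|x] /=; rewrite ?H0 ?H1//.
move=> p; apply: (@continuous_comp _ _ _ (fun p => H (p.1, k p.2)) h); last exact: ch.
apply: (@continuous_comp _ _ _ (fun p : R * X => (p.1, k p.2)) H); last exact: cH.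
apply: continuous_pair => {}p; first exact: cvg_fst.
by apply: (@continuous_comp _ _ _ snd k); [exact: cvg_snd|exact: ck].
Qed.

Lemma homotopy_equivalent_sym (X Y : topologicalType) :
  homotopy_equivalent R X Y -> homotopy_equivalent R Y X.
Proof. by move=> [f [g [? ? ? ?]]]; exists g, f. Qed.

Lemma homotopy_equivalent_trans (X Y Z : topologicalType) :
  homotopy_equivalent R X Y -> homotopy_equivalent R Y Z ->
  homotopy_equivalent R X Z.
Proof.
move=> [f [g [cf cg gf fg]]] [f' [g' [cf' cg' gf' fg']]].
exists (f' \o f), (g \o g'); split.
- exact: continuous_funcomp.
- exact: continuous_funcomp.
- by apply: homotopic_trans gf; apply: (homotopic_comp cf cg gf').
- by apply: homotopic_trans fg'; apply: (homotopic_comp cg' cf' fg).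
Qed.

Lemma homeo_equivalent (X Y : topologicalType) (f : X -> Y) (g : Y -> X) :
  continuous f -> continuous g -> cancel f g -> cancel g f ->
  homotopy_equivalent R X Y.
Proof.
move=> cf cg fK gK; exists f, g; split => //.
  have -> : g \o f = idfun by apply/funext => x /=; rewrite fK.
  by apply: homotopic_refl => x; exact: cvg_id.
have -> : f \o g = idfun by apply/funext => x /=; rewrite gK.
by apply: homotopic_refl => x; exact: cvg_id.
Qed.

End Homotopy.

(** * Geometric realizations *)

Section Realization.
Variables (R : realType) (V : finType) (K : scomplex V).
Implicit Types x y : realization R K.

Definition bary x (v : V) : R := set_val x v.

Definition supp x : {set V} := [set v | bary x v != 0]%SET.

Lemma baryP x : realization_set R K (bary x).
Proof. exact: set_valP. Qed.

Lemma bary_ge0 x v : 0 <= bary x v.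
Proof. by have [] := baryP x. Qed.

Lemma bary_sum x : \sum_v bary x v = 1.
Proof. by have [] := baryP x. Qed.

Lemma supp_simplex x : supp x \in simplices K.
Proof. by have [] := baryP x. Qed.

Lemma mem_supp x v : (v \in supp x) = (0 < bary x v).
Proof. by rewrite inE lt_def bary_ge0 andbT. Qed.

Lemma bary_eq0 x v : v \notin supp x -> bary x v = 0.
Proof. by rewrite inE negbK => /eqP. Qed.

Lemma bary_ext x y : bary x =1 bary y -> x = y.
Proof. by move=> xy; apply/val_inj/funext => v; exact: xy. Qed.

Lemma bary_continuous v : continuous (fun x => bary x v).
Proof.
apply: (@continuous_funcomp _ _ _ (set_val : realization R K -> _)
  (fun f : {ptws V -> R} => f v)); first exact: set_val_continuous.
exact: eval_ptws_continuous.
Qed.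

Definition point_of (f : V -> R) (hf : realization_set R K f) : realization R K :=
  SigSub (mem_set hf).

Lemma bary_point_of f hf v : bary (@point_of f hf) v = f v.
Proof. by []. Qed.

(** The simplices being finite in number, the realization is a subspace of a
    finite product of lines, and continuity is checked on coordinates. *)
Lemma continuous_realization (X : topologicalType) (f : X -> realization R K) :
  (forall v, continuous (fun p => bary (f p) v)) -> continuous f.
Proof.
by move=> cf; apply: continuous_set_type; apply: continuous_ptws => v; exact: cf.
Qed.

(** The support of barycentric coordinates is never empty because they add up
    to 1; hence it is enough to locate it inside a simplex. *)
Lemma supp_sub_realization (f : V -> R) (s : {set V}) :
  (forall v, 0 <= f v) -> \sum_v f v = 1 -> s \in simplices K ->
  (forall v, f v != 0 -> v \in s) -> realization_set R K f.
Proof.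
move=> f0 f1 sK fs; split => //; apply: (simplex_sub sK).
  by apply/fintype.subsetP => v; rewrite inE => /fs.
apply/negP => /eqP/setP f00; move/eqP: f1; rewrite big1 ?(eq_sym 0) ?oner_eq0// => v _.
by apply/eqP/negPn; have := f00 v; rewrite !inE => ->.
Qed.

End Realization.

Section LinearHomotopy.
Variables (R : realType) (V : finType) (K : scomplex V) (X : topologicalType).
Variables (f g : X -> realization R K).
Hypotheses (cf : continuous f) (cg : continuous g).
Hypothesis fg : forall x, (supp (f x) :|: supp (g x))%SET \in simplices K.

Let mix (p : R * X) v := (1 - clamp p.1) * bary (f p.2) v + clamp p.1 * bary (g p.2) v.

Let mixP p : realization_set R K (mix p).
Proof.
have /andP[t0 t1] := clamp_itv p.1; have t1' : 0 <= 1 - clamp p.1 by rewrite subr_ge0.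
apply: (supp_sub_realization (s := (supp (f p.2) :|: supp (g p.2))%SET)) => //.
- by move=> v; rewrite /mix addr_ge0// mulr_ge0// bary_ge0.
- by rewrite big_split/= -!mulr_sumr !bary_sum !mulr1 subrK.
- move=> v; apply: contraR; rewrite finset.in_setU negb_or => /andP[/bary_eq0 fv /bary_eq0 gv].
  by rewrite /mix fv gv !mulr0 addr0.
Qed.

(** The segment from [f x] to [g x] stays in the closed simplex spanned by the
    two supports, so the straight-line homotopy never leaves the complex. *)
Lemma linear_homotopic : homotopic R f g.
Proof.
apply/homotopicP; exists (fun p => point_of (mixP p)); split => [|x|x].
- apply: continuous_realization => v.
  rewrite (_ : (fun _ => _) = fun p => mix p v)//.
  have cc : continuous (fun p : R * X => clamp p.1).
    apply: (@continuous_funcomp _ _ _ (fst : R * X -> R) (@clamp R)); last exact: clamp_continuous.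
    by move=> p; exact: cvg_fst.
  have cb (h : X -> realization R K) : continuous h ->
      continuous (fun p : R * X => bary (h p.2) v).
    move=> ch; apply: (@continuous_funcomp _ _ _ (snd : R * X -> X) (fun x => bary (h x) v)).
      by move=> p; exact: cvg_snd.
    by apply: (@continuous_funcomp _ _ _ h (fun y => bary y v)) => //; exact: bary_continuous.
  apply: continuous_add; apply: continuous_mul => //; try exact: cb.
  by apply: continuous_sub => //; exact: continuous_cst.
- apply: bary_ext => v; rewrite bary_point_of /mix/= clamp_id ?lexx ?ler01//.
  by rewrite subr0 mul1r mul0r addr0.
- apply: bary_ext => v; rewrite bary_point_of /mix/= clamp_id ?lexx ?ler01//.
  by rewrite subrr mul1r mul0r add0r.
Qed.

End LinearHomotopy.

Section SimplicialMap.
Variables (R : realType) (V W : finType) (K : scomplex V) (L : scomplex W).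

Definition simplicial (phi : V -> W) :=
  forall s, s \in simplices K -> (phi @: s)%SET \in simplices L.

Variable phi : V -> W.
Hypothesis sphi : simplicial phi.

Let pushf (x : realization R K) w := \sum_(v | phi v == w) bary x v.

Let pushP x : realization_set R L (pushf x).
Proof.
apply: (supp_sub_realization (s := (phi @: supp x)%SET)).
- by move=> w; apply: sumr_ge0 => v _; exact: bary_ge0.
- rewrite -[RHS](bary_sum x) (partition_big phi xpredT)//=.
- exact/sphi/supp_simplex.
- move=> w; apply: contraR => wx; apply/eqP/big1 => v /eqP vw.
  by apply: bary_eq0; apply: contra wx => vx; rewrite -vw imset_f.
Qed.

Definition realize_map (x : realization R K) : realization R L := point_of (pushP x).

Lemma bary_realize_map x w : bary (realize_map x) w = \sum_(v | phi v == w) bary x v.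
Proof. by []. Qed.

Lemma supp_realize_map x : supp (realize_map x) = (phi @: supp x)%SET.
Proof.
apply/setP => w; rewrite mem_supp; apply/idP/imsetP => [|[v vx ->]].
  rewrite lt_def bary_ge0 andbT => wx; apply: contrapT => nw.
  move/eqP: wx; apply; apply: big1 => v /eqP vw; apply: bary_eq0.
  by apply/negP => vx; apply: nw; exists v.
rewrite bary_realize_map (bigD1 v)//= ltr_wpDr -?mem_supp//.
by apply: sumr_ge0 => u _; exact: bary_ge0.
Qed.

Lemma realize_map_continuous : continuous realize_map.
Proof.
apply: continuous_realization => w.
rewrite (_ : (fun _ => _) = fun x => \sum_(v | phi v == w) bary x v)//.
by apply: continuous_sumr => v; exact: bary_continuous.
Qed.

End SimplicialMap.

Section Contiguity.
Variables (R : realType) (V W : finType) (K : scomplex V) (L : scomplex W).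
Variables (phi : V -> W) (psi : W -> V).
Hypotheses (sphi : simplicial K L phi) (spsi : simplicial L K psi).

(** Each composite moves a point within a common simplex of the point and its
    image, so straight-line homotopies connect the composites to identities.
    This covers relabelling of vertices as well as the insertion and removal of
    dominated vertices. *)
Lemma contiguity_equivalent :
  (forall s, s \in simplices K -> (s :|: psi @: (phi @: s))%SET \in simplices K) ->
  (forall s, s \in simplices L -> (s :|: phi @: (psi @: s))%SET \in simplices L) ->
  homotopy_equivalent R (realization R K) (realization R L).
Proof.
move=> cK cL; exists (realize_map sphi), (realize_map spsi); split.
- exact: realize_map_continuous.
- exact: realize_map_continuous.
- apply: linear_homotopic; last first.
  + by move=> x; rewrite /= finset.setUC !supp_realize_map cK// supp_simplex.
  + by move=> x; exact: cvg_id.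
  + by apply: continuous_funcomp; exact: realize_map_continuous.
- apply: linear_homotopic; last first.
  + by move=> x; rewrite /= finset.setUC !supp_realize_map cL// supp_simplex.
  + by move=> x; exact: cvg_id.
  + by apply: continuous_funcomp; exact: realize_map_continuous.
Qed.

End Contiguity.

(** * Deleting a dominated edge of a flag complex *)

Section FlagComplex.
Variables (V : finType) (c : rel V).

(** A vertex is an element compatible with itself: [c] need not be reflexive,
    which allows vertices to be deleted without changing the type [V]. *)
Definition flag_simplices : {set {set V}} :=
  [set s : {set V} | (s != finset.set0) &&
    [forall x in s, forall y in s, c x y]]%SET.

Fact flag_neq0 s : s \in flag_simplices -> s != finset.set0.
Proof. by rewrite inE => /andP[]. Qed.

Lemma mem_flag (s : {set V}) : reflect
  (s != finset.set0 /\ {in s &, forall x y, c x y}) (s \in flag_simplices).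
Proof.
rewrite inE; apply: (iffP andP) => -[-> h]; split => //.
  by move=> x y xs ys; have /forall_inP/(_ _ xs)/forall_inP := h; exact.
by apply/forall_inP => x xs; apply/forall_inP => y ys; exact: h.
Qed.

Fact flag_sub (s u : {set V}) :
  u \in flag_simplices -> s \subset u -> s != finset.set0 -> s \in flag_simplices.
Proof.
move=> /mem_flag[_ h] /fintype.subsetP su s0; apply/mem_flag; split => // x y xs ys.
by apply: h; exact: su.
Qed.

Definition flag_complex : scomplex V := SComplex flag_neq0 flag_sub.

End FlagComplex.

Lemma simplicial_flag (V W : finType) (c : rel V) (d : rel W) (phi : V -> W) :
  (forall x y, c x x -> c y y -> c x y -> d (phi x) (phi y)) ->
  simplicial (flag_complex c) (flag_complex d) phi.
Proof.
move=> h s /mem_flag[s0 sc]; apply/mem_flag; split.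
  by rewrite imset_eq0.
by move=> _ _ /imsetP[x xs ->] /imsetP[y ys ->]; apply: h; apply: sc.
Qed.

(** For [u = v] this deletes the vertex [u]. *)
Definition del_edge (V : eqType) (c : rel V) (u v : V) : rel V :=
  [rel x y | c x y && ~~ ((x == u) && (y == v) || (x == v) && (y == u))].

Section EdgeDeletion.
Variables (R : realType) (V : finType) (c : rel V) (u v a : V).
Hypotheses (csym : symmetric c) (au : a != u) (av : a != v).
Hypothesis dom : c u u -> c v v -> c u v ->
  forall w, c w u -> c w v -> c w a.

Local Notation K := (flag_complex c).
Local Notation L := (flag_complex (del_edge c u v)).
Local Notation e := [set u; v]%SET.
Implicit Type x : realization R K.

Let m x := Num.min (bary x u) (bary x v).

Let m_ge0 x : 0 <= m x.
Proof. by rewrite le_min !bary_ge0. Qed.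

(* a simplex containing the whole trajectory of [x] under the push *)
Let big_supp x := if 0 < m x then (a |: supp x)%SET else supp x.

Let supp_big x : supp x \subset big_supp x.
Proof. by rewrite /big_supp; case: ifP => // _; exact: finset.subsetUr. Qed.

Let big_supp_simplex x : big_supp x \in simplices K.
Proof.
rewrite /big_supp; case: ifPn => [|_]; last exact: supp_simplex.
rewrite lt_min -!mem_supp => /andP[ux vx].
have /mem_flag[s0 sc] := supp_simplex x.
have ca w : w \in supp x -> c w a by move=> wx; apply: dom; exact: sc.
have cua := ca _ ux; have cva := ca _ vx.
have caa : c a a by apply: dom; rewrite ?(csym a)//; exact: sc.
apply/mem_flag; split => [|w w'].
  by apply/set0Pn; exists a; rewrite finset.setU11.
rewrite !finset.in_setU1 => /predU1P[->|wx] /predU1P[->|w'x] //.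
- by rewrite csym ca.
- exact: ca.
- exact: sc.
Qed.

(* As long as both [u] and [v] have positive weight, the smaller of the two
   weights is taken away from each element of [[set u; v]] and given to [a].
   The factor [#|e|] keeps the total weight equal to 1, in both cases [u != v]
   and [u = v]. *)
Let pushf x w := bary x w + m x * ((w == a)%:R * #|e|%:R - (w \in e)%:R).

Let a_notin : a \notin e.
Proof. by rewrite !inE negb_or au av. Qed.

Let pushf_ge0 x w : 0 <= pushf x w.
Proof.
rewrite /pushf; have [->|wa] := eqVneq w a.
  by rewrite (negbTE a_notin) subr0 addr_ge0 ?bary_ge0// !mulr_ge0.
rewrite mul0r sub0r mulrN subr_ge0; case: (boolP (w \in e)) => [|_]; last first.
  by rewrite mulr0 bary_ge0.
by rewrite mulr1 !inE ge_min => /orP[]/eqP ->; rewrite lexx ?orbT.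
Qed.

Let pushf_sum x : \sum_w pushf x w = 1.
Proof.
rewrite big_split/= bary_sum -mulr_sumr sumrB -mulr_suml.
rewrite (bigD1 a)//= eqxx big1 ?addr0; last by move=> w /negbTE ->.
suff -> : \sum_w (w \in e)%:R = #|e|%:R :> R by rewrite mul1r subrr mulr0 addr0.
by rewrite -sum1_card natr_sum [RHS]big_mkcond/=; apply: eq_bigr => w _; case: ifP.
Qed.

Let pushf_supp x w : pushf x w != 0 -> w \in big_supp x.
Proof.
rewrite /big_supp; case: ifPn => m0; last first.
  have mx0 : m x = 0 by apply/eqP; rewrite eq_le m_ge0 leNgt m0.
  by rewrite /pushf mx0 mul0r addr0 inE.
rewrite finset.in_setU1; have [//|wa] := eqVneq w a.
apply: contraNT => /= wx.
have := pushf_ge0 x w; rewrite /pushf (bary_eq0 wx) (negbTE wa) mul0r sub0r add0r.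
by rewrite mulrN oppr_ge0 oppr_eq0 eq_le mulr_ge0// andbT.
Qed.

Let pushf_separates x : pushf x u != 0 -> pushf x v != 0 -> False.
Proof.
rewrite /pushf ![_ == a]eq_sym (negbTE au) (negbTE av) mul0r sub0r !inE !eqxx orbT/=.
by rewrite !sub0r !mulrN1 !subr_eq0 /m; case: leP; rewrite eqxx ?andbF.
Qed.

Let pushP x : realization_set R L (pushf x).
Proof.
apply: (supp_sub_realization (s := [set w | pushf x w != 0]%SET)).
- exact: pushf_ge0.
- exact: pushf_sum.
- have /mem_flag[_ bc] := big_supp_simplex x.
  apply/mem_flag; split => [|w w'].
    apply/negP => /eqP/setP p0; have /eqP := pushf_sum x.
    rewrite big1 ?(eq_sym 0) ?oner_eq0// => w _.
    by apply/eqP/negPn; have := p0 w; rewrite !inE => ->.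
  rewrite !inE => pw pw'; rewrite /del_edge/= bc ?pushf_supp//=.
  by apply/negP => /orP[]/andP[/eqP wE /eqP w'E]; move: pw pw'; rewrite wE w'E;
    [|move=> /[swap]]; exact: pushf_separates.
- by move=> w; rewrite inE.
Qed.

Let push x : realization R L := point_of (pushP x).

Let push_continuous : continuous push.
Proof.
apply: continuous_realization => w.
rewrite (_ : (fun _ => _) = fun x => pushf x w)//.
apply: continuous_add; first exact: bary_continuous.
apply: continuous_mul; last exact: continuous_cst.
by apply: continuous_minr; exact: bary_continuous.
Qed.

Let incl_simplicial : simplicial L K id.
Proof. by apply: simplicial_flag => x y _ _ /andP[]. Qed.

Let bary_incl (y : realization R L) w : bary (realize_map incl_simplicial y) w = bary y w.
Proof. by rewrite bary_realize_map big_pred1_eq. Qed.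

(** Every simplex containing [u] and [v] can be enlarged by [a], so the weight
    carried by the edge [uv] can be pushed towards [a] inside one simplex until
    [u] or [v] has disappeared from the support. The push is the identity on
    points whose support does not contain both [u] and [v], hence it is a
    deformation retraction onto the smaller complex. *)
Lemma flag_del_edge :
  homotopy_equivalent R (realization R K) (realization R L).
Proof.
exists push, (realize_map incl_simplicial); split.
- exact: push_continuous.
- exact: realize_map_continuous.
- apply: linear_homotopic.
  + by apply: continuous_funcomp; [exact: push_continuous|exact: realize_map_continuous].
  + by move=> x; exact: cvg_id.
  + move=> x; apply: (simplex_sub (big_supp_simplex x)).
      rewrite finset.subUset supp_big andbT; apply/fintype.subsetP => w.
      by rewrite inE /= bary_incl; exact: pushf_supp.
    by apply/set0Pn; have [/set0Pn[w wx] _] := mem_flag _ _ (supp_simplex x);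
      exists w; rewrite finset.in_setU wx orbT.
- have -> : push \o realize_map incl_simplicial = idfun.
    apply/funext => y; apply: bary_ext => w /=; rewrite bary_point_of /pushf !bary_incl.
    suff -> : m (realize_map incl_simplicial y) = 0 by rewrite mul0r addr0.
    apply/eqP; rewrite eq_le m_ge0 andbT leNgt lt_min !bary_incl -!mem_supp.
    apply/negP => /andP[uy vy]; have /mem_flag[_ /(_ _ _ uy vy)] := supp_simplex y.
    by rewrite /del_edge/= !eqxx andbF.
  by apply: homotopic_refl => y; exact: cvg_id.
Qed.

End EdgeDeletion.

(** * Independence complexes of cycles *)

Section FlagEquivalences.
Variable R : realType.

Lemma flag_contiguity (V W : finType) (c : rel V) (d : rel W)
    (phi : V -> W) (psi : W -> V) :
  symmetric c -> symmetric d ->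
  (forall x y, c x x -> c y y -> c x y -> d (phi x) (phi y)) ->
  (forall x y, d x x -> d y y -> d x y -> c (psi x) (psi y)) ->
  (forall x y, c x x -> c y y -> c x y -> c x (psi (phi y))) ->
  (forall x y, d x x -> d y y -> d x y -> d x (phi (psi y))) ->
  homotopy_equivalent R (realization R (flag_complex c)) (realization R (flag_complex d)).
Proof.
move=> csym dsym hphi hpsi hc hd.
have contig (T U : finType) (f : rel T) (g : rel U) (p : T -> U) (q : U -> T) :
    symmetric f -> (forall x y, f x x -> f y y -> f x y -> g (p x) (p y)) ->
    (forall x y, g x x -> g y y -> g x y -> f (q x) (q y)) ->
    (forall x y, f x x -> f y y -> f x y -> f x (q (p y))) ->
    forall s, s \in simplices (flag_complex f) ->
      (s :|: q @: (p @: s))%SET \in simplices (flag_complex f).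
  move=> fsym hp hq hf s /mem_flag[/set0Pn[z zs] sf]; apply/mem_flag; split => [|x y].
    by apply/set0Pn; exists z; rewrite finset.in_setU zs.
  rewrite !finset.in_setU => /orP[xs|/imsetP[_ /imsetP[x' xs ->] ->]]
    /orP[ys|/imsetP[_ /imsetP[y' ys ->] ->]].
  - exact: sf.
  - by apply: hf; apply: sf.
  - by rewrite fsym; apply: hf; apply: sf.
  - by apply: hq; apply: hp; apply: sf.
apply: (@contiguity_equivalent R _ _ _ _ phi psi).
- exact: simplicial_flag.
- exact: simplicial_flag.
- exact: (contig _ _ c d).
- exact: (contig _ _ d c).
Qed.

Lemma del_edge_sym (V : eqType) (c : rel V) u v :
  symmetric c -> symmetric (del_edge c u v).
Proof.
move=> csym x y; rewrite /del_edge/= csym; congr (_ && ~~ _).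
by rewrite orbC; congr (_ || _); rewrite andbC.
Qed.

(** The vertex [a] must dominate the edge [uv] in the smaller relation [c'];
    then it does so at every intermediate step, and the edges can be removed one
    at a time in any order. *)
Lemma flag_prune (V : finType) (c c' : rel V) :
  symmetric c -> symmetric c' -> subrel c' c ->
  (forall u v, c u v -> ~~ c' u v -> exists a,
    [/\ a != u, a != v & forall w, c w u -> c w v -> c' w a]) ->
  homotopy_equivalent R (realization R (flag_complex c)) (realization R (flag_complex c')).
Proof.
move=> + c'sym.
have [n] := ubnP #|[set p : V * V | c p.1 p.2 && ~~ c' p.1 p.2]%SET|.
elim: n c => // n IH c cn csym sub dom.
case: (pickP [pred p : V * V | c p.1 p.2 && ~~ c' p.1 p.2]) => [[u v] /=|none]; last first.
  have -> : c = c'.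
    apply/funext => x; apply/funext => y; apply/idP/idP => [cxy|]; last exact: sub.
    by have /= := none (x, y); rewrite cxy => /negbFE.
  by apply: (homeo_equivalent R (f := id) (g := id)) => // x; exact: cvg_id.
move=> /andP[cuv cuv']; have [a [au av auv]] := dom _ _ cuv cuv'.
have sub' : subrel c' (del_edge c u v).
  move=> x y xy; rewrite /del_edge/= sub//=; apply: contra cuv' => /orP[]/andP[/eqP xu /eqP yv].
    by rewrite -xu -yv.
  by rewrite -xu -yv c'sym.
apply: (homotopy_equivalent_trans (Y := realization R (flag_complex (del_edge c u v)))).
  by apply: (flag_del_edge R csym au av) => _ _ _ w wu wv; apply/sub/auv.
apply: IH => //; last 2 first.
- exact: del_edge_sym.
- move=> x y /andP[cxy _] /(dom _ _ cxy)[b [bx byy bd]].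
  by exists b; split => // w /andP[wx _] /andP[wy _]; exact: bd.
rewrite -ltnS; apply: leq_trans cn; rewrite ltnS; apply: proper_card; apply/properP; split.
  by apply/fintype.subsetP => p; rewrite !inE => /andP[/andP[-> _] ->].
exists (u, v); first by rewrite inE /= cuv.
by rewrite inE /= /del_edge/= !eqxx andbF.
Qed.

(** The graph whose independence complex is considered after some reductions:
    the vertices [0, ..., m - 1] form a cycle and the remaining ones are cut
    into consecutive paths of three vertices, starting at the indices congruent
    to [m] modulo 3. When [m] is the number of vertices this is the whole cycle.
    For [m = 1] the cycle is a loop at [0], which removes this vertex from the
    complex, and for [m = 2] it is a single edge. *)
Definition stage_up (m : nat) : rel nat := fun x y =>
  ((y == x.+1) && ((y < m) || (y %% 3 != m %% 3)) || (x == 0) && (y == m.-1))%N.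

Definition stage_adj m : rel nat := fun x y => stage_up m x y || stage_up m y x.

Definition stage N m : rel 'I_N := fun x y => ~~ stage_adj m x y.

Lemma stage_sym N m : symmetric (@stage N m).
Proof. by move=> x y; rewrite /stage /stage_adj orbC. Qed.

(** The two graphs of a reduction step become equal once the chord that closes
    the short cycle is added to the first, and the two edges that attach the new
    path [m, m + 1, m + 2] to the short cycle are added to the second. *)
Lemma stage_up_step m x y : (0 < m)%N ->
  stage_up (m + 3) x y || (x == 0) && (y == m.-1) =
  [|| stage_up m x y, (x == 0) && (y == m.+2) | (x == m.-1) && (y == m)]%N.
Proof.
rewrite /stage_up modnDr => m0.
by have [->|] := eqVneq y x.+1; lia.
Qed.

(** Splitting a path of three vertices off the cycle takes three changes of a
    single edge of the graph, each dominated by a vertex [a] all of whose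
    neighbours are adjacent to one of the two ends:
    - add the chord from [0] to [m - 1], with [a = m + 1];
    - remove the edge from [m - 1] to [m], with [a = m + 2];
    - remove the edge from [0] to [m + 2], with [a = m].
    An edge of the graph being a forbidden pair of the complex, adding an edge
    is a deletion in the sense of [flag_del_edge], and removing one is the
    reverse of a deletion. *)
Lemma stage_step N m : (0 < m)%N -> (m + 3 <= N)%N ->
  homotopy_equivalent R (realization R (flag_complex (@stage N (m + 3))))
    (realization R (flag_complex (@stage N m))).
Proof.
move=> m0 mN.
have N0 : (0 < N)%N by lia. have N1 : (m.-1 < N)%N by lia.
have N2 : (m < N)%N by lia. have N3 : (m.+1 < N)%N by lia.
have N4 : (m.+2 < N)%N by lia.
pose X := del_edge (@stage N m) (Ordinal N0) (Ordinal N4).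
have Xsym : symmetric X by apply: del_edge_sym; exact: stage_sym.
have XE : del_edge (@stage N (m + 3)) (Ordinal N0) (Ordinal N1) =
          del_edge X (Ordinal N1) (Ordinal N2).
  apply/funext => x; apply/funext => y.
  rewrite /X /del_edge /stage /stage_adj /= -!val_eqE /= -!negb_or; congr negb.
  rewrite (andbC (val x == m.-1)) (andbC (val x == m)) (andbC (val x == m.+2)).
  have taut : forall a b c d e a' b' c' d' e', a || b = [|| c, d | e] ->
      a' || b' = [|| c', d' | e'] ->
      [|| a || a', b | b'] = [|| [|| c || c', d | d'], e | e'].
    by do 10!case.
  exact: taut (stage_up_step x y m0) (stage_up_step y x m0).
apply: (homotopy_equivalent_trans
  (Y := realization R (flag_complex (del_edge X (Ordinal N1) (Ordinal N2))))).
  rewrite -XE; apply: (flag_del_edge R (a := Ordinal N3)); first exact: stage_sym.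
  - by rewrite -val_eqE.
  - by rewrite -val_eqE/=; lia.
  - move=> _ _ _ w /= w0 w1; apply/negP => w2.
    have : (val w == m) || (val w == m.+2).
      by move: w2; rewrite /= /stage_adj /stage_up modnDr; lia.
    move=> /orP[]/eqP wE.
    + by move: w1; rewrite /stage wE /stage_adj /stage_up modnDr /=; lia.
    + by move: w0; rewrite /stage wE /stage_adj /stage_up modnDr /=; lia.
have nbr a : stage_adj m a m.+2 -> a = m.+1.
  by rewrite /stage_adj /stage_up; lia.
have nbr' a : stage_adj m a m -> a = m.+1.
  by rewrite /stage_adj /stage_up; lia.
have adj : stage_adj m m.+1 m by rewrite /stage_adj /stage_up; lia.
have adj' : stage_adj m m.+1 m.+2 by rewrite /stage_adj /stage_up; lia.
have adj0 : stage_adj m 0 m.-1 by rewrite /stage_adj /stage_up; lia.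
apply: (homotopy_equivalent_trans (Y := realization R (flag_complex X))).
  apply: homotopy_equivalent_sym; apply: (flag_del_edge R (a := Ordinal N4)) => //.
  - by rewrite -val_eqE/=; lia.
  - by rewrite -val_eqE/=; lia.
  - move=> _ _ _ w /andP[/= w1 _] /andP[/= w2 _]; rewrite /X /del_edge /= -!val_eqE/=.
    apply/andP; split.
      by apply/negP => /nbr wE; move: w2; rewrite /stage wE adj.
    apply/negP => /orP[/andP[/eqP w0 _]|/andP[]//].
    by move: w1; rewrite /stage w0 adj0.
apply: homotopy_equivalent_sym; apply: (flag_del_edge R (a := Ordinal N2)).
- exact: stage_sym.
- by rewrite -val_eqE/=; lia.
- by rewrite -val_eqE/=; lia.
- move=> _ _ _ w _ /= w2; apply/negP => /nbr' wE.
  by move: w2; rewrite /stage wE adj'.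
Qed.

Lemma stage_reduce N m j : (0 < m)%N -> N = (m + 3 * j)%N ->
  homotopy_equivalent R (realization R (flag_complex (@stage N N)))
    (realization R (flag_complex (@stage N m))).
Proof.
elim: j m => [|j IH] m m0 NE.
  by rewrite NE muln0 addn0; apply: (homeo_equivalent R (f := id) (g := id)) => // x; exact: cvg_id.
apply: homotopy_equivalent_trans (stage_step m0 _); last by lia.
by apply: IH; lia.
Qed.

(** The flag complex of [cross_rel] is the boundary of the cross-polytope with
    the [k] pairs of opposite vertices [(j, true)] and [(j, false)]. *)
Definition cross_rel (k : nat) : rel ('I_k * bool) :=
  fun x y => (x.1 == y.1) ==> (x.2 == y.2).

(** Final graphs of the first two residues in coordinates: [j] is the number of
    a path and [p] the position in it. For [r = 1] the looped vertex [0] has no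
    coordinates; for [r = 2] the edge [01] is the path number [0] without its
    first vertex. *)
Lemma stage_up_blocks r x y j p j' p' : (0 < r < 3)%N -> (p < 3)%N -> (p' < 3)%N ->
  (x.+1 + r.*2 = 3 * j + p + 4)%N -> (y.+1 + r.*2 = 3 * j' + p' + 4)%N ->
  stage_up r x y = (j == j') && (p' == p.+1).
Proof.
case: r => [|[|[|//]]]// _ p3 p3' hx hy; rewrite /stage_up.
  case: p p3 hx => [|[|[|//]]] _ hx; case: p' p3' hy => [|[|[|//]]] _ hy; lia.
case: p p3 hx => [|[|[|//]]] _ hx; case: p' p3' hy => [|[|[|//]]] _ hy; lia.
Qed.

Lemma stage_adj_blocks r x y j p j' p' : (0 < r < 3)%N -> (p < 3)%N -> (p' < 3)%N ->
  (x.+1 + r.*2 = 3 * j + p + 4)%N -> (y.+1 + r.*2 = 3 * j' + p' + 4)%N ->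
  stage_adj r x y = (j == j') && ((p == 1%N) != (p' == 1%N)).
Proof.
move=> r3 p3 p3' hx hy; rewrite /stage_adj.
rewrite (stage_up_blocks r3 p3 p3' hx hy) (stage_up_blocks r3 p3' p3 hy hx).
rewrite (eq_sym j'); case: eqP => //= _.
by case: p p3 {hx} => [|[|[|//]]]; case: p' p3' {hy} => [|[|[|//]]].
Qed.

(** The two ends of a path of three vertices have the same neighbour, so they
    may be merged; each path then contributes one pair of opposite vertices. *)
Lemma stage_cross r N k : (0 < r < 3)%N -> (N + r.*2 = 3 * k.+1 + 3)%N ->
  homotopy_equivalent R (realization R (flag_complex (@stage N r)))
    (realization R (flag_complex (@cross_rel k.+1))).
Proof.
move=> r3 NE; have N0 : (0 < N)%N by lia.
(* With this shift [x.+1 - d] is three times the number of the path of [x] plus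
   the position of [x] in it, for both values of [r]. The middle vertex of a
   path is sent to [true], and [psi] chooses the last vertex for [false]. *)
pose d := (4 - r.*2)%N.
pose phi (x : 'I_N) : 'I_k.+1 * bool := (inord ((x.+1 - d) %/ 3), (x.+1 - d) %% 3 == 1)%N.
pose psi (p : 'I_k.+1 * bool) : 'I_N := insubd (Ordinal N0) (3 * p.1 + d + 1 - p.2)%N.
have psiE p : ((psi p).+1 + r.*2 = 3 * p.1 + (2 - p.2) + 4)%N.
  rewrite /psi val_insubd ifT /d; case: p => -[j jk] [] /=; lia.
have psi3 (b : bool) : (2 - b < 3)%N by case: b.
have psi1 (b : bool) : (2 - b == 1)%N = b by case: b.
have phiE (x : 'I_N) : stage r x x -> exists p, [/\ (p < 3)%N,
    (x.+1 + r.*2 = 3 * (phi x).1 + p + 4)%N & (phi x).2 = (p == 1%N)].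
  move=> xx; exists ((x.+1 - d) %% 3)%N; split => //; first exact: ltn_pmod.
  have dx : (d <= x.+1)%N.
    move: xx; rewrite /stage /stage_adj /stage_up /d.
    have [->|->] : r = 1%N \/ r = 2%N by lia.
      by case: (nat_of_ord x).
    by [].
  have dE : (d + r.*2 = 4)%N by rewrite /d; lia.
  have := divn_eq (x.+1 - d) 3; have := ltn_pmod (x.+1 - d) (isT : 0 < 3)%N.
  by have xN := ltn_ord x => p3 E; rewrite /phi /= inordK; lia.
have phi_psi p : phi (psi p) = p.
  have := psiE p; case: p => j b /= pE; rewrite /phi.
  have -> : ((psi (j, b)).+1 - d = 3 * j + (2 - b))%N by rewrite /d; lia.
  congr pair; last by rewrite mulnC modnMDl; case: b {pE}.
  by apply: val_inj; rewrite /= mulnC divnMDl// divn_small// addn0 inordK.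
apply: (@flag_contiguity _ _ _ _ phi psi).
- exact: stage_sym.
- by move=> x y; rewrite /cross_rel eq_sym (eq_sym x.2).
- move=> x y /phiE[p [p3 xE xp]] /phiE[p' [p3' yE yp]].
  rewrite /stage (stage_adj_blocks r3 p3 p3' xE yE) /cross_rel xp yp.
  by rewrite negb_and negbK -implybE.
- move=> x y _ _; rewrite /stage (stage_adj_blocks r3 _ _ (psiE x) (psiE y))// !psi1.
  by rewrite negb_and negbK -implybE.
- move=> x y /phiE[p [p3 xE xp]] /phiE[p' [p3' yE yp]].
  rewrite /stage (stage_adj_blocks r3 p3 p3' xE yE).
  by rewrite (stage_adj_blocks r3 p3 _ xE (psiE _))// psi1 yp.
- by move=> x y _ _; rewrite phi_psi.
Qed.

End FlagEquivalences.

(** * From three points to two glued cross-polytopes *)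

Section GluedCrossPolytopes.
Variables (R : realType) (k : nat).

Local Notation vertex := (bool * ('I_k.+1 * bool))%type.

(** Vertices of two copies of a cross-polytope, indexed by a boolean; the copies
    of the vertex [(ord0, true)] are to be identified, and the element
    [(true, (ord0, true))] stands for both. *)
Definition glue_point : vertex := (true, (ord0, true)).

Definition alive (x : vertex) := x != (false, (ord0, true)).

(** The pairs with index [ord0] supply three pairwise incompatible vertices,
    the triangle of the last graph; every other vertex occurs twice. *)
Definition doubled_rel : rel vertex := fun x y =>
  [&& alive x, alive y &
    (x.2.1 == y.2.1) ==> (x.2.2 == y.2.2) && ((x.2.1 == ord0) ==> (x.1 == y.1))].

(** The two vertices of index [ord0] other than the glue point are now attached
    to their own copy only. *)
Definition sided_rel : rel vertex := fun x y => doubled_rel x y &&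
  [|| x.1 == y.1, x == glue_point, y == glue_point
    | (x.2.1 != ord0) && (y.2.1 != ord0)].

Definition glued_rel : rel vertex := fun x y =>
  [&& alive x, alive y, cross_rel x.2 y.2 &
    [|| x.1 == y.1, x == glue_point | y == glue_point]].

Lemma doubled_sym : symmetric doubled_rel.
Proof.
move=> [b [j e]] [b' [j' e']]; rewrite /doubled_rel andbCA !(eq_sym _ j) (eq_sym _ e) (eq_sym _ b) /=.
by do 2 congr (_ && _); case: eqP => //= ->.
Qed.

Lemma sided_sym : symmetric sided_rel.
Proof.
move=> x y; rewrite /sided_rel doubled_sym (eq_sym x.1) (andbC (x.2.1 != _)).
by congr (_ && (_ || _)); rewrite orbCA.
Qed.

Lemma glued_sym : symmetric glued_rel.
Proof.
move=> x y; rewrite /glued_rel andbCA /cross_rel (eq_sym x.1) (eq_sym x.2.1) (eq_sym x.2.2).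
by do 3 congr (_ && _); rewrite (orbC (x == _)).
Qed.

(** An edge from [u] of index [ord0] to [v] in the other copy is dominated by
    the duplicate of [v] in the copy of [u]. *)
Lemma doubled_sided :
  homotopy_equivalent R (realization R (flag_complex doubled_rel))
    (realization R (flag_complex sided_rel)).
Proof.
have key u v : doubled_rel u v -> u.2.1 = ord0 -> ~~ sided_rel u v -> exists a,
    [/\ a != u, a != v & forall w, doubled_rel w u -> doubled_rel w v -> sided_rel w a].
  move=> uv u0; rewrite /sided_rel uv /= !negb_or => /and4P[bb uq vq].
  rewrite u0 eqxx /= => _.
  have vj : v.2.1 != ord0.
    apply: contraNneq bb => v0; have /and3P[_ _] := uv.
    by rewrite u0 v0 eqxx /= => /andP[].
  exists (u.1, v.2); split.
  - by apply: contraNneq vj => E; rewrite -u0 -[in eqbRHS]E.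
  - by apply: contraNneq bb => E; rewrite -[in eqbRHS]E.
  - move=> w wu wv; rewrite /=.
    have /and3P[wa _ ua] := wu; have /and3P[_ _ va] := wv.
    rewrite /doubled_rel wa /= vj /alive /=.
    have -> : (u.1, v.2) != (false, (ord0, true)).
      by apply: contraNneq vj => -[_ ->].
    move: ua va; rewrite u0; have [wv1|wv1] := eqVneq w.2.1 v.2.1.
      by rewrite wv1 vj (negbTE vj) /= !andbT !orbT => _ ->.
    have [w0|w0] := eqVneq w.2.1 ord0; last by rewrite /= !orbT.
    by move=> /= /andP[_ /eqP ->]; rewrite eqxx.
apply: flag_prune; [exact: doubled_sym|exact: sided_sym|by move=> x y /andP[]|].
move=> u v uv uv'; have [u0|u0] := eqVneq u.2.1 ord0; first exact: key.
have [v0|v0] := eqVneq v.2.1 ord0.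
  have [||a [av au h]] := key v u _ v0; rewrite 1?doubled_sym 1?sided_sym//.
  by exists a; split => // w wu wv; exact: h.
by move: uv'; rewrite /sided_rel uv u0 v0 !orbT.
Qed.

(** Edges between the two copies are dominated by the glue point, to which all
    vertices but the two others of index [ord0] are attached. *)
Lemma sided_glued :
  homotopy_equivalent R (realization R (flag_complex sided_rel))
    (realization R (flag_complex glued_rel)).
Proof.
apply: flag_prune; [exact: sided_sym|exact: glued_sym| |].
- move=> x y /and4P[xa ya /implyP xy2 xyb]; apply/andP; split; last first.
    by case/or3P: xyb => ->; rewrite ?orbT.
  rewrite /doubled_rel xa ya /=; apply/implyP => j; rewrite xy2//=.
  apply/implyP => /eqP x0; move: xyb => /or3P[//|/eqP xq|/eqP yq].
  + move: ya j (xy2 j); rewrite xq /alive /=; case: (y) => -[] [j' e] //= ya /eqP jE /eqP eE.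
    by move: ya; rewrite -eE -jE eqxx.
  + move: xa j (xy2 j); rewrite yq /alive /=; case: (x) => -[] [j' e] //= xa /eqP jE /eqP eE.
    by move: xa; rewrite eE jE eqxx.
- move=> u v /andP[/and3P[ua va uv] side] nuv.
  have uvc : cross_rel u.2 v.2 by apply/implyP => j; move: uv; rewrite j => /andP[].
  move: nuv; rewrite /glued_rel ua va uvc /= !negb_or => /and3P[bb uq vq].
  move: side; rewrite (negbTE bb) (negbTE uq) (negbTE vq) /= => /andP[u0 v0].
  exists glue_point; split; rewrite 1?eq_sym// => w /andP[/and3P[wa _ _] wu] /andP[_ wv].
  rewrite eqxx !orbT !andbT wa /=.
  have [->|wq] := eqVneq w glue_point; first by rewrite /cross_rel !eqxx.
  apply/implyP => /= /eqP w0; move: wu wv.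
  rewrite w0 eqxx /= !orbF (negbTE wq) (negbTE uq) (negbTE vq) /= !orbF => /eqP wu /eqP wv.
  by move: bb; rewrite -wu -wv eqxx.
Qed.

Lemma stage_up3 j p j' p' : (p < 3)%N -> (p' < 3)%N ->
  stage_up 3 (3 * j + p) (3 * j' + p') =
  (j == j') && ((p' == p.+1) || [&& j == 0, p == 0 & p' == 2])%N.
Proof.
move=> p3 p3'; rewrite /stage_up.
by case: p p3 => [|[|[|//]]] _; case: p' p3' => [|[|[|//]]] _; lia.
Qed.

Lemma stage_adj3 j p j' p' : (p < 3)%N -> (p' < 3)%N ->
  stage_adj 3 (3 * j + p) (3 * j' + p') =
  (j == j') && (if j == 0 then p != p' else (p == 1) != (p' == 1))%N.
Proof.
move=> p3 p3'; rewrite /stage_adj !stage_up3// (eq_sym j').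
case: eqP => //= <-; case: (j == 0)%N;
by case: p p3 => [|[|[|//]]] _; case: p' p3' => [|[|[|//]]] _.
Qed.

(** The paths of three vertices are merged to pairs and these are doubled at the
    same time: a vertex and its duplicate have the same neighbours. *)
Lemma stage_doubled N : N = (3 * k.+1)%N ->
  homotopy_equivalent R (realization R (flag_complex (@stage N 3)))
    (realization R (flag_complex doubled_rel)).
Proof.
move=> NE; have N0 : (0 < N)%N by lia.
(* Position in a block of three: all positions of the block [0] are used, for the
   triangle; in a path, the middle vertex stands for [true] and the last one for
   [false], in both copies. *)
pose off (v : vertex) : nat :=
  if v.2.1 == ord0 then (if v.2.2 then 0 else if v.1 then 1 else 2)%N
  else (2 - v.2.2)%N.
pose phi (v : vertex) : 'I_N := insubd (Ordinal N0) (3 * v.2.1 + off v)%N.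
pose psi (x : 'I_N) : vertex :=
  ((x : nat) != 2%N, (inord (x %/ 3), if (x < 3)%N then (x : nat) == 0%N else x %% 3 == 1)%N).
have off3 v : (off v < 3)%N.
  by rewrite /off; case: v.2.1 v.2.2 v.1 => ? ? [] []; case: ifP.
have phiE v : phi v = (3 * v.2.1 + off v)%N :> nat.
  rewrite /phi val_insubd ifT// NE; have := off3 v; have := ltn_ord v.2.1; lia.
have xE (x : 'I_N) : (3 * (psi x).2.1 + x %% 3 = x)%N.
  by have := ltn_ord x => xN; rewrite /psi /= inordK; lia.
have psi_off x : alive (psi x) /\
    off (psi x) = (if (psi x).2.1 == ord0 then x %% 3 else 2 - (x %% 3 == 1))%N.
  have x3 : ((psi x).2.1 == ord0) = (x < 3)%N.
    by rewrite -val_eqE; have := xE x; move: (psi x).2.1 => j /=; lia.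
  rewrite /alive /off; split.
    rewrite /psi !xpair_eqE; case: (eqVneq (x : nat) 2%N) => [x2|//] /=.
    by rewrite x2 andbF.
  rewrite x3; rewrite /psi /=; case: ifP => x3'; last by rewrite x3'.
  by rewrite x3' modn_small//; case: (nat_of_ord x) x3' => [|[|[|]]].
have psi_phi v : alive v ->
    psi (phi v) = (if v.2.1 == ord0 then v.1 else true, v.2).
  case: v => b [j e] va.
  have dE : (phi (b, (j, e)) %/ 3 = j)%N.
    by rewrite phiE mulnC divnMDl// divn_small ?off3// addn0.
  have mE : (phi (b, (j, e)) %% 3 = off (b, (j, e)))%N.
    by rewrite phiE mulnC modnMDl modn_small// off3.
  rewrite /psi dE mE phiE /off /= inord_val.
  have [j0|j0] := eqVneq j ord0.
    by move: va; rewrite /alive j0 muln0 !xpair_eqE eqxx; case: b {dE mE}; case: e.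
  have j1 : (0 < j)%N by rewrite lt0n.
  by rewrite ifF; [congr (_, (_, _)); [lia|case: e {va dE mE}]|lia].
have doubledE v w : alive v -> alive w ->
    doubled_rel v w = ~~ stage_adj 3 (phi v) (phi w).
  case: v w => [b [j e]] [b' [j' e']]; rewrite /doubled_rel => va wa.
  rewrite va wa !phiE stage_adj3 ?off3// /off /= -!val_eqE /= negb_and -implybE.
  case: eqP => //= jj; rewrite -jj.
  case: (eqVneq (j : nat) 0%N) => /= j0; last by case: e {va}; case: e' {wa}.
  by move: va wa; rewrite /alive !xpair_eqE -!val_eqE /= -jj j0;
    case: e; case: e'; case: b; case: b'.
have stageE : forall x y : 'I_N, stage 3 x y = ~~ ((val (psi x).2.1 == (psi y).2.1) &&
    (if val (psi x).2.1 == 0 then x %% 3 != y %% 3 else (x %% 3 == 1) != (y %% 3 == 1)))%N.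
  by move=> x y; rewrite /stage -{1}(xE x) -{1}(xE y) stage_adj3 ?ltn_pmod.
apply: (@flag_contiguity _ _ _ _ _ psi phi).
- exact: stage_sym.
- exact: doubled_sym.
- move=> x y _ _; rewrite stageE.
  have [ax ox] := psi_off x; have [ay oy] := psi_off y.
  rewrite doubledE// !phiE stage_adj3 ?off3// ox oy -!val_eqE /=.
  move: ((psi x).2.1 : nat) ((psi y).2.1 : nat) => j j'.
  have [<-|//] := eqVneq j j'; case: (j == 0)%N => //=.
  by case: (_ %% _ == 1)%N; case: (_ %% _ == 1)%N.
- by move=> v w /and3P[va _ _] /and3P[wa _ _]; rewrite doubledE.
- move=> x y _ _; rewrite stageE.
  have [ay oy] := psi_off y.
  have -> : stage 3 x (phi (psi y)) =
      ~~ stage_adj 3 (3 * (psi x).2.1 + x %% 3)%N (3 * (psi y).2.1 + off (psi y))%N.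
    by rewrite /stage phiE xE.
  rewrite stage_adj3 ?off3 ?ltn_pmod// oy -!val_eqE /=.
  move: ((psi x).2.1 : nat) ((psi y).2.1 : nat) => j j'.
  have [<-|//] := eqVneq j j'; case: (j == 0)%N => //=.
  by case: (_ %% _ == 1)%N; case: (_ %% _ == 1)%N.
- move=> [b [j e]] [b' [j' e']] /and3P[va _ _] /and3P[wa _ _]; rewrite psi_phi// /doubled_rel va wa /=.
  move: wa; rewrite /alive !xpair_eqE => wa vw; apply/andP; split.
    by case: ifP wa => [j0|_]; rewrite ?xpair_eqE ?j0.
  apply/implyP => jj; move: vw; rewrite jj /= => /andP[-> /=].
  by rewrite (eqP jj); case: eqP.
Qed.

End GluedCrossPolytopes.

(** * The boundary of the cross-polytope is a sphere *)

Lemma continuous_row (R : realType) (X : topologicalType) n (f : X -> 'rV[R]_n) :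
  (forall j, continuous (fun x => f x ord0 j)) -> continuous f.
Proof.
move=> cf x A [P Px PA].
have : nbhs x [set y | forall j, P ord0 j (f y ord0 j)].
  by apply: filter_forall => j; apply: (cf j x); exact: Px.
by apply: filterS => y yP; apply: PA => i j; rewrite (ord1 i).
Qed.

Section CrossPolytopeSphere.
Variables (R : realType) (k : nat).

Local Notation cross := (realization R (flag_complex (@cross_rel k.+1))).

Definition scoord (z : sphere R k) (j : 'I_k.+1) : R := set_val z ord0 j.

Lemma scoord_sqr z : \sum_j scoord z j ^+ 2 = 1.
Proof. exact: (set_valP z). Qed.

Lemma scoord_continuous j : continuous (fun z => scoord z j).
Proof.
apply: (@continuous_funcomp _ _ _ (set_val : sphere R k -> _)
  (fun M : 'rV[R]_k.+1 => M ord0 j)); first exact: set_val_continuous.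
exact: coord_continuous.
Qed.

Lemma scoord_ext z z' : scoord z =1 scoord z' -> z = z'.
Proof. by move=> zz; apply/val_inj/rowP => j; exact: zz. Qed.

Definition sphere_point (f : 'I_k.+1 -> R) (hf : \sum_j f j ^+ 2 = 1) : sphere R k.
Proof.
apply: (@SigSub _ _ _ (\row_j f j)); apply/mem_set; rewrite /sphere_set /= -[RHS]hf.
by apply: eq_bigr => j _; rewrite mxE.
Defined.

Lemma scoord_sphere_point f hf j : scoord (@sphere_point f hf) j = f j.
Proof. by rewrite /scoord set_valE /= mxE. Qed.

Lemma continuous_sphere (X : topologicalType) (f : X -> sphere R k) :
  (forall j, continuous (fun x => scoord (f x) j)) -> continuous f.
Proof.
by move=> cf; apply: continuous_set_type; apply: continuous_row => j; exact: cf.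
Qed.

(* The map to the sphere: at most one of two opposite vertices has positive
   weight, so that their difference loses no information. *)
Let diff (x : cross) (j : 'I_k.+1) := bary x (j, true) - bary x (j, false).

Let cross_disjoint (x : cross) j : bary x (j, true) = 0 \/ bary x (j, false) = 0.
Proof.
have /mem_flag[_ sc] := supp_simplex x.
have [jt|/bary_eq0] := boolP ((j, true) \in supp x); last by left.
right; apply: bary_eq0; apply/negP => jf.
by have := sc _ _ jt jf; rewrite /cross_rel eqxx.
Qed.

Let diff_bary x j b : bary x (j, b) = Num.max 0 (if b then diff x j else - diff x j).
Proof.
have xt := bary_ge0 x (j, true); have xf := bary_ge0 x (j, false).
rewrite /diff; case: (cross_disjoint x j) => E; rewrite E; case: b;
  rewrite ?subr0 ?sub0r ?opprK ?oppr0.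
- by rewrite E max_l ?oppr_le0.
- by rewrite max_r.
- by rewrite max_r.
- by rewrite E max_l ?oppr_le0.
Qed.

Let sum_cross (F : 'I_k.+1 * bool -> R) : \sum_p F p = \sum_j (F (j, true) + F (j, false)).
Proof.
rewrite (eq_bigr (fun p => F (p.1, p.2))); last by case.
rewrite -(pair_bigA _ (fun j b => F (j, b))) /=.
by apply: eq_bigr => j _; rewrite big_bool.
Qed.

Let diff_norm1 x : \sum_j `|diff x j| = 1.
Proof.
rewrite -(bary_sum x) sum_cross; apply: eq_bigr => j _; rewrite /diff.
by case: (cross_disjoint x j) => ->;
  rewrite ?sub0r ?subr0 ?normrN ger0_norm ?bary_ge0 ?add0r ?addr0.
Qed.

Let norm2 x := Num.sqrt (\sum_j diff x j ^+ 2).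

Let norm2_gt0 x : 0 < norm2 x.
Proof.
rewrite sqrtr_gt0 lt_def sumr_ge0 ?andbT; last by move=> j _; exact: sqr_ge0.
apply/negP => /eqP/psumr_eq0P d0; have := diff_norm1 x; rewrite big1 => [/eqP|j _].
  by rewrite eq_sym oner_eq0.
apply/normr0P; rewrite -sqrf_eq0; apply/eqP/d0 => // i _; exact: sqr_ge0.
Qed.

Let to_sphere_proof x : \sum_j (diff x j / norm2 x) ^+ 2 = 1.
Proof.
rewrite (eq_bigr (fun j => diff x j ^+ 2 / norm2 x ^+ 2)); last first.
  by move=> j _; rewrite expr_div_n.
rewrite -mulr_suml sqr_sqrtr; last by apply: sumr_ge0 => j _; exact: sqr_ge0.
by rewrite divff// gt_eqF// -sqrtr_gt0 norm2_gt0.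
Qed.

Definition cross_to_sphere (x : cross) : sphere R k := sphere_point (to_sphere_proof x).

Let diff_continuous j : continuous (fun x => diff x j).
Proof. by apply: continuous_sub; exact: bary_continuous. Qed.

Lemma cross_to_sphere_continuous : continuous cross_to_sphere.
Proof.
apply: continuous_sphere => j.
rewrite (_ : (fun _ => _) = (fun x => diff x j * (norm2 x)^-1)); last first.
  by apply/funext => x; rewrite scoord_sphere_point.
apply: continuous_mul; first exact: diff_continuous.
apply: continuous_inv => [x|]; first by rewrite gt_eqF.
apply: continuous_sqrt; apply: continuous_sumr => i.
by apply: continuous_mul; exact: diff_continuous.
Qed.

Let norm1 (z : sphere R k) := \sum_j `|scoord z j|.

Let norm1_gt0 z : 0 < norm1 z.
Proof.
rewrite lt_def sumr_ge0 ?andbT//; apply/negP => /eqP/psumr_eq0P z0.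
have := scoord_sqr z; rewrite big1 => [/eqP|j _]; first by rewrite eq_sym oner_eq0.
by apply/eqP; rewrite sqrf_eq0 -normr_eq0; apply/eqP/z0.
Qed.

(* The inverse map: positive and negative parts of the coordinates, normalized
   by the sum of their absolute values. *)
Let part (z : sphere R k) (p : 'I_k.+1 * bool) : R :=
  Num.max 0 (if p.2 then scoord z p.1 else - scoord z p.1) / norm1 z.

Let of_sphere_proof z : realization_set R (flag_complex (@cross_rel k.+1)) (part z).
Proof.
apply: (supp_sub_realization (s := [set p | part z p != 0]%SET)).
- by move=> p; rewrite divr_ge0 ?(ltW (norm1_gt0 z))// le_max lexx.
- rewrite sum_cross /part /=; under eq_bigr do rewrite -mulrDl.
  rewrite -mulr_suml -[RHS](divff (lt0r_neq0 (norm1_gt0 z))); congr (_ / _).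
  apply: eq_bigr => j _; case: (leP 0 (scoord z j)) => zj.
    by rewrite [Num.max 0 (- _)]max_l ?oppr_le0// addr0 ger0_norm.
  by rewrite [Num.max 0 (- _)]max_r ?oppr_ge0 ?(ltW zj)// add0r ltr0_norm.
- apply/mem_flag; split.
    have [j zj] : exists j, scoord z j != 0.
      apply/existsP; apply: contraT; rewrite negb_exists => /forallP z0.
      have := norm1_gt0 z; rewrite /norm1 big1 ?ltxx// => j _.
      by apply/normr0P; have := z0 j; rewrite negbK.
    apply/set0Pn; exists (j, 0 < scoord z j); rewrite inE /part /=.
    rewrite mulf_neq0 ?invr_eq0 ?gt_eqF//.
    case: (ltrgtP 0 (scoord z j)) zj => // zj _; first by rewrite lt_max zj orbT.
    by rewrite lt_max oppr_gt0 zj orbT.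
  move=> [j b] [j' b']; rewrite !inE /part !mulf_eq0 !negb_or /= => /andP[zb _] /andP[zb' _].
  apply/implyP => /= /eqP jj; move: zb zb'; rewrite -{}jj.
  have pos (a : R) : Num.max 0 a != 0 -> 0 < a by case: ltP => //; rewrite eqxx.
  move=> /pos + /pos; case: b; case: b' => //; rewrite oppr_gt0.
    by move=> zj /lt_trans/(_ zj); rewrite ltxx.
  by move=> /lt_trans zj /zj; rewrite ltxx.
- by move=> p; rewrite inE.
Qed.

Definition sphere_to_cross (z : sphere R k) : cross := point_of (of_sphere_proof z).

Lemma sphere_to_cross_continuous : continuous sphere_to_cross.
Proof.
apply: continuous_realization => -[j b].
rewrite (_ : (fun _ => _) = (fun z => part z (j, b)))//.
apply: continuous_mul.
  apply: continuous_maxr; first exact: continuous_cst.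
  case: b; first exact: scoord_continuous.
  rewrite (_ : (fun _ => _) = (fun z => 0 - scoord z j)); last first.
    by apply/funext => z; rewrite sub0r.
  by apply: continuous_sub; [exact: continuous_cst|exact: scoord_continuous].
apply: continuous_inv => [z|]; first by rewrite gt_eqF.
by apply: continuous_sumr => i; apply: continuous_norm; exact: scoord_continuous.
Qed.

Lemma cross_to_sphereK : cancel cross_to_sphere sphere_to_cross.
Proof.
move=> x; apply: bary_ext => -[j b]; rewrite bary_point_of /part /= diff_bary.
have -> : norm1 (cross_to_sphere x) = (norm2 x)^-1.
  rewrite /norm1 (eq_bigr (fun j => `|diff x j| / norm2 x)).
    by rewrite -mulr_suml diff_norm1 mul1r.
  by move=> i _; rewrite scoord_sphere_point normf_div (gtr0_norm (norm2_gt0 x)).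
have n0 := norm2_gt0 x; rewrite scoord_sphere_point invrK -mulNr.
rewrite -[if b then _ else _](_ : (if b then diff x j else - diff x j) / norm2 x = _); last by case: b.
by rewrite maxr_pMl ?ltW// mul0r mulfVK ?gt_eqF//.
Qed.

Lemma sphere_to_crossK : cancel sphere_to_cross cross_to_sphere.
Proof.
move=> z; apply: scoord_ext => j; rewrite scoord_sphere_point.
have dE i : diff (sphere_to_cross z) i = scoord z i / norm1 z.
  rewrite /diff !bary_point_of /part /= -mulrBl; congr (_ / _).
  case: (leP 0 (scoord z i)) => zi.
    by rewrite max_l ?oppr_le0// subr0.
  by rewrite max_r ?oppr_ge0 ?(ltW zi)// sub0r opprK.
have n0 := norm1_gt0 z.
have -> : norm2 (sphere_to_cross z) = (norm1 z)^-1.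
  rewrite /norm2 (eq_bigr (fun i => scoord z i ^+ 2 / norm1 z ^+ 2)); last first.
    by move=> i _; rewrite dE expr_div_n.
  by rewrite -mulr_suml scoord_sqr mul1r -exprVn sqrtr_sqr gtr0_norm// invr_gt0.
by rewrite dE invrK mulfVK ?gt_eqF.
Qed.

(** Radial projection, from the unit sphere of the 1-norm to that of the
    Euclidean norm. *)
Lemma cross_sphere : homotopy_equivalent R cross (sphere R k).
Proof.
apply: homeo_equivalent cross_to_sphereK sphere_to_crossK.
- exact: cross_to_sphere_continuous.
- exact: sphere_to_cross_continuous.
Qed.

Lemma bary_sphere_base p :
  bary (sphere_to_cross (sphere_base R k)) p = (p == (ord0, true))%:R.
Proof.
have sE j : scoord (sphere_base R k) j = (j == ord0)%:R.
  by rewrite /scoord set_valE /= mxE eqxx.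
rewrite bary_point_of /part; have -> : norm1 (sphere_base R k) = 1.
  rewrite /norm1 (bigD1 ord0)//= sE eqxx normr1 big1 ?addr0// => j /negbTE j0.
  by rewrite sE j0 normr0.
case: p => j b; rewrite divr1 /= sE xpair_eqE.
by case: b; case: eqP => _ /=; rewrite ?oppr0 ?maxxx // ?(max_r ler01)// max_l ?oppr_le0.
Qed.

End CrossPolytopeSphere.

(** * Two cross-polytopes glued at a vertex form a wedge *)

Lemma realize_map_cancel (R : realType) (V W : finType) (K : scomplex V) (L : scomplex W)
    (phi : V -> W) (psi : W -> V) (sphi : simplicial K L phi) (spsi : simplicial L K psi)
    (x : realization R K) :
  {in supp x, cancel phi psi} -> realize_map spsi (realize_map sphi x) = x.
Proof.
move=> phiK; apply: bary_ext => v.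
rewrite bary_realize_map; under eq_bigr do rewrite bary_realize_map.
rewrite (exchange_big_dep xpredT)//=.
rewrite (bigD1 v)//= [X in _ + X]big1 ?addr0 => [|u uv].
  have [vx|/bary_eq0 vx] := boolP (v \in supp x); last first.
    by rewrite big1 ?vx.
  rewrite (eq_bigl (pred1 (phi v))) ?big_pred1_eq// => w /=.
  by rewrite [phi v == w]eq_sym andbC; case: eqP => //= ->; rewrite phiK ?eqxx.
apply: big1 => w /andP[/eqP wv /eqP uw]; apply: bary_eq0; apply: contraNN uv => ux.
by rewrite -wv -uw phiK.
Qed.

Section Wedge.
Variables (R : realType) (k : nat).

Local Notation cross_complex := (flag_complex (@cross_rel k.+1)).
Local Notation glued_complex := (flag_complex (@glued_rel k)).
Local Notation vertex := (bool * ('I_k.+1 * bool))%type.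
Local Notation base := ((ord0, true) : 'I_k.+1 * bool).
Local Notation S := (sphere R k).
Local Notation family := (fun b : bool => if b then (S : ptopologicalType) else (S : ptopologicalType)).

Definition copy_in (b : bool) (v : 'I_k.+1 * bool) : vertex :=
  if v == base then glue_point k else (b, v).

Definition copy_out (b : bool) (w : vertex) : 'I_k.+1 * bool :=
  if w.1 == b then w.2 else base.

Lemma copy_in_simplicial b : simplicial cross_complex glued_complex (copy_in b).
Proof.
apply: simplicial_flag => u v _ _ uv.
have snd_copy_in w : (copy_in b w).2 = w by rewrite /copy_in; case: eqP.
have copy_in_alive w : alive (copy_in b w).
  rewrite /copy_in /alive; case: ifPn => wb; first by rewrite xpair_eqE.
  by rewrite xpair_eqE negb_and wb orbT.
rewrite /glued_rel !copy_in_alive !snd_copy_in uv /= /copy_in.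
by case: (u == base); case: (v == base); rewrite ?eqxx ?orbT.
Qed.

Lemma copy_out_simplicial b : simplicial glued_complex cross_complex (copy_out b).
Proof.
apply: simplicial_flag => -[c u] [d v]; rewrite /glued_rel /alive /= => _ _.
case/and4P => cu dv uv; rewrite /copy_out /= !xpair_eqE => h.
have refl w : @cross_rel k.+1 w w by apply/implyP.
case: (eqVneq c b) h cu => [->|cb]; case: (eqVneq d b) dv => [->|db]; rewrite ?(eq_sym b) => dv h cu //.
- by case/or3P: h => // /andP[_ /eqP E]; rewrite -?E// E.
- case/or3P: h => [/eqP cE|/andP[_ /eqP E]|/andP[_ /eqP E]].
  + by rewrite cE eqxx in cb.
  + by rewrite -E.
  + by rewrite E.
Qed.

Let incl b : realization R cross_complex -> realization R glued_complex :=
  realize_map (copy_in_simplicial b).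
Let coll b : realization R glued_complex -> realization R cross_complex :=
  realize_map (copy_out_simplicial b).

(* total weight outside the copy [b], which is the zero set of [side b] *)
Let side b (x : realization R glued_complex) : R :=
  \sum_(w | (w.1 != b) && (w != glue_point k)) bary x w.

Let side_continuous b : continuous (side b).
Proof. by apply: continuous_sumr => w; exact: bary_continuous. Qed.

Let side0 b x w : side b x = 0 -> w \in supp x -> w.1 = b \/ w = glue_point k.
Proof.
move=> /psumr_eq0P s0 wx; have [|wb] := eqVneq w.1 b; first by left.
have [|wg] := eqVneq w (glue_point k); first by right.
move: wx; rewrite mem_supp s0 ?wb ?wg ?ltxx// => i _; exact: bary_ge0.
Qed.

Let side_cover x : side true x = 0 \/ side false x = 0.
Proof.
have [//|/eqP xt] := eqVneq (side true x) 0; first by left.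
right; apply: big1 => w /andP[wf wg]; apply: bary_eq0; apply/negP => wx.
apply: xt; apply: big1 => v /andP[vt vg]; apply: bary_eq0; apply/negP => vx.
have /mem_flag[_ /(_ _ _ wx vx)/and4P[_ _ _]] := supp_simplex x.
rewrite (negbTE wg) (negbTE vg) !orbF => /eqP wv.
by move: vt wf; rewrite wv; case: v.1.
Qed.

Let side_incl b y : side b (incl b y) = 0.
Proof.
apply: big1 => w /andP[wb wg]; apply: bary_eq0; rewrite supp_realize_map.
apply/imsetP => -[v _ E]; move: wb wg; rewrite E /copy_in.
by case: (v == base); rewrite eqxx.
Qed.

Let inclK b y : coll b (incl b y) = y.
Proof.
apply: realize_map_cancel => v _; rewrite /copy_out /copy_in.
by case: (eqVneq v base) => [->|_] /=; rewrite ?eqxx//; case: b.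
Qed.

Let collK b x : side b x = 0 -> incl b (coll b x) = x.
Proof.
move=> xb; apply: realize_map_cancel => w wx; rewrite /copy_out /copy_in.
have /mem_flag[_ /(_ _ _ wx wx)/andP[wa _]] := supp_simplex x.
have [wb|->] := side0 xb wx.
  rewrite wb eqxx; case: (eqVneq w.2 base) => [w2|_]; last by rewrite -wb -surjective_pairing.
  by move: wa; rewrite /alive (surjective_pairing w) w2 /glue_point; case: w.1.
by rewrite /glue_point /=; case: b {xb}; rewrite eqxx.
Qed.

Let f := @cross_to_sphere R k.
Let g := @sphere_to_cross R k.

Let bary_incl_base b w :
  bary (incl b (g (sphere_base R k))) w = (w == glue_point k)%:R.
Proof.
rewrite bary_realize_map big_mkcond (bigD1 base)//= big1 ?addr0 => [|v /negbTE vb].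
  by rewrite bary_sphere_base eqxx /copy_in eqxx eq_sym; case: eqP.
by rewrite bary_sphere_base vb if_same.
Qed.

(* the two copies only meet in the glue point *)
Let coll_glue b x : side true x = 0 -> side false x = 0 ->
  f (coll b x) = sphere_base R k.
Proof.
move=> xt xf; rewrite -[RHS]sphere_to_crossK; congr f; rewrite -[RHS](inclK b); congr coll.
have supp_x w : w \in supp x -> w = glue_point k.
  move=> wx; have [wt|//] := side0 xt wx; have [wf|//] := side0 xf wx.
  by move: wt; rewrite wf.
have x0 w : w != glue_point k -> bary x w = 0.
  by move=> wg; apply: bary_eq0; apply: contraNN wg => /supp_x ->.
apply: bary_ext => w; rewrite bary_incl_base; case: eqP => [->|/eqP/x0 //].
by have := bary_sum x; rewrite (bigD1 (glue_point k))//= big1 ?addr0.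
Qed.

Local Notation W := (wedge2 S S).

Let lift (b : bool) : S -> W :=
  match b with
  | true => @wedge_lift bool _ (fun b => @point (family b)) true
  | false => @wedge_lift bool _ (fun b => @point (family b)) false
  end.

Let lift_continuous b : continuous (lift b).
Proof.
case: b.
  exact: (@wedge_lift_continuous bool family (fun b => @point (family b)) true).
exact: (@wedge_lift_continuous bool family (fun b => @point (family b)) false).
Qed.

Let lift_base b c : lift b (sphere_base R k) = lift c (sphere_base R k).
Proof.
case: b; case: c => //.
  exact: (@wedge_liftE bool family (fun b => @point (family b)) false point true point).
exact: (@wedge_liftE bool family (fun b => @point (family b)) true point false point).
Qed.

(* the maps of the two spheres, with the dependent type expected by [wedge_fun] *)
Let branch (b : bool) : family b -> realization R glued_complex :=
  match b return family b -> realization R glued_complex with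
  | true => incl true \o g
  | false => incl false \o g
  end.

Let branch_base b c : branch (@point (family b)) = branch (@point (family c)).
Proof.
suff base_eq d : branch (@point (family d)) = incl true (g (sphere_base R k)).
  by rewrite !base_eq.
by case: d => //=; apply: bary_ext => w; rewrite !bary_incl_base.
Qed.

Let of_wedge : W -> realization R glued_complex := wedge_fun branch.

Let of_wedge_lift b z : of_wedge (lift b z) = incl b (g z).
Proof. by case: b; rewrite /of_wedge /lift wedge_lift_funE//; exact: branch_base. Qed.

Let of_wedge_continuous : continuous of_wedge.
Proof.
apply: wedge_fun_continuous; last exact: branch_base.
have incl_g b : continuous (incl b \o g).
  apply: continuous_funcomp; first exact: sphere_to_cross_continuous.
  exact: realize_map_continuous.
by case; exact: incl_g.
Qed.

Let to_wedge x : W :=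
  if side true x == 0 then lift true (f (coll true x))
  else lift false (f (coll false x)).

Let to_wedge_side b x : side b x = 0 -> to_wedge x = lift b (f (coll b x)).
Proof.
rewrite /to_wedge; case: b => xb; first by rewrite xb eqxx.
by case: eqP => // xt; rewrite !coll_glue//; exact: lift_base.
Qed.

Let to_wedge_continuous : continuous to_wedge.
Proof.
have cb b : continuous (fun x => lift b (f (coll b x))).
  apply: (@continuous_funcomp _ _ _ (fun x => f (coll b x)) (lift b)); last exact: lift_continuous.
  apply: (@continuous_funcomp _ _ _ (coll b) f); last exact: cross_to_sphere_continuous.
  exact: realize_map_continuous.
apply: (@continuous_closed_cover _ _ (side true @^-1` [set 0]) (side false @^-1` [set 0])).
- by apply: closed_comp => [x _|]; [exact: side_continuous|exact: closed_eq].
- by apply: closed_comp => [x _|]; [exact: side_continuous|exact: closed_eq].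
- exact: side_cover.
- exact: (cb true).
- exact: (cb false).
- by move=> x; exact: to_wedge_side.
- by move=> x; exact: to_wedge_side.
Qed.

(** The wedge maps to the glued complex by the inclusions of the two copies,
    which agree at the base point. The inverse is defined on the two closed
    sets of points supported in one copy; these cover the complex because no
    simplex has vertices in both copies other than the glue point. *)
Lemma glued_wedge :
  homotopy_equivalent R (realization R glued_complex) (wedge2 (sphere R k) (sphere R k)).
Proof.
apply: (homeo_equivalent R to_wedge_continuous of_wedge_continuous) => [x|w].
  have [xs|xs] := side_cover x;
    rewrite (to_wedge_side xs) of_wedge_lift (cross_to_sphereK _ : g (f _) = _);
    exact: collK.
have : (\bigcup_b (@wedge_lift bool family (fun b => @point (family b)) b) @` setT) w.
  by rewrite wedgeTE.
have to_of_wedge b z : to_wedge (of_wedge (lift b z)) = lift b z.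
  by rewrite of_wedge_lift (to_wedge_side (side_incl b _)) inclK (sphere_to_crossK _ : f (g _) = _).
by case=> -[] _ [z _ <-]; [exact: (to_of_wedge true)|exact: (to_of_wedge false)].
Qed.

End Wedge.

(** * The Morse complex of a cycle *)

Section MorseComplexOfCycle.
Variables (R : realType) (t : nat).
Hypothesis t3 : (2 < t)%N.

Local Notation K := (cycle_complex t).
Local Notation N := (2 * t)%N.
Local Notation pair := ({set 'I_t} * {set 'I_t})%type.

Let half_lt (x : 'I_N) : (x %/ 2 < t)%N.
Proof. by rewrite ltn_divLR// [(t * 2)%N]mulnC. Qed.

Let edge_of (x : 'I_N) : 'I_t := Ordinal (half_lt x).

Let tip (x : 'I_N) : 'I_t := if odd x then ordS (edge_of x) else edge_of x.

(** The Hasse diagram of the cycle is a cycle of length [2 * t], whose edge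
    number [x] joins the edge [x %/ 2] of the complex to its first or second
    end, according to the parity of [x]. *)
Definition arrow (x : 'I_N) : pair :=
  ([set tip x], [set edge_of x; ordS (edge_of x)])%SET.

Let ordSE (i : 'I_t) : val (ordS i) = (if i.+1 == t then 0 else i.+1)%N.
Proof.
rewrite /=; have := ltn_ord i; case: eqP => [->|ne it]; first by rewrite modnn.
by rewrite modn_small; lia.
Qed.

Let ordS_neq (i : 'I_t) : i != ordS i.
Proof. by rewrite -val_eqE ordSE /=; case: ifP; lia. Qed.

Let card_edge (i : 'I_t) : #|[set i; ordS i]%SET| = 2.
Proof. by rewrite cards2 ordS_neq. Qed.

Let edge_inj (i j : 'I_t) : [set i; ordS i]%SET = [set j; ordS j]%SET -> i = j.
Proof.
move=> E; have : i \in [set j; ordS j]%SET by rewrite -E !inE eqxx.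
have : ordS i \in [set j; ordS j]%SET by rewrite -E !inE eqxx orbT.
rewrite !inE -!val_eqE !ordSE => h1 h2; apply: val_inj => /=.
by have := ltn_ord i; have := ltn_ord j; move: h1 h2 => /=; do 2 case: ifP; lia.
Qed.

Let tipE (x : 'I_N) : val (tip x) = (if x.+1 == N then 0 else x.+1 %/ 2)%N.
Proof.
rewrite /tip; have := ltn_ord x; case: ifP => ox xN; rewrite ?ordSE /=; last first.
  by rewrite ifF; lia.
by case: ifP; case: ifP; lia.
Qed.

Lemma arrow_inj : injective arrow.
Proof.
move=> x y [/finset.set1_inj/(congr1 val)/= + /edge_inj/(congr1 val)/=].
rewrite !tipE => h1 h2; apply: val_inj => /=; move: h1.
by have := ltn_ord x; have := ltn_ord y; do 2 case: ifP; lia.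
Qed.

(** Two distinct pairs are in conflict exactly if they share a vertex or an edge
    of the complex, that is, if they are consecutive. *)
Lemma arrow_adjacent (x y : 'I_N) : stage_adj N x y =
  (x != y) && (((arrow x).1 == (arrow y).1) || ((arrow x).2 == (arrow y).2)).
Proof.
have -> : ((arrow x).1 == (arrow y).1) = (tip x == tip y).
  by apply/eqP/eqP => [/finset.set1_inj|/= ->].
have -> : ((arrow x).2 == (arrow y).2) = (edge_of x == edge_of y).
  by apply/eqP/eqP => [/edge_inj|/= ->].
rewrite -!val_eqE !tipE /= /stage_adj /stage_up.
have xN := ltn_ord x; have yN := ltn_ord y; rewrite xN yN /=.
by case: (x.+1 =P N) => ?; case: (y.+1 =P N) => ?; apply/idP/idP; lia.
Qed.

Let vertex_or_edge (s : {set 'I_t}) : s \in simplices K <->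
  s != finset.set0 /\ exists i, s \subset [set i; ordS i]%SET.
Proof.
rewrite inE; split=> [/andP[-> /exists_inP[_ /imsetP[i _ ->] si]]|[-> [i si]]].
  by split => //; exists i.
by apply/exists_inP; exists [set i; ordS i]%SET => //; apply/imsetP; exists i.
Qed.

Lemma arrow_primitive x : primitive_vector K (arrow x).
Proof.
have sub : [set tip x]%SET \subset [set edge_of x; ordS (edge_of x)]%SET.
  by rewrite finset.sub1set /tip !inE; case: odd; rewrite eqxx ?orbT.
apply/and4P; split => //=; last by rewrite /sdim card_edge cards1.
  apply/vertex_or_edge; split; last by exists (edge_of x).
  by apply/set0Pn; exists (tip x); rewrite inE.
apply/vertex_or_edge; split; last by exists (edge_of x).
by apply/set0Pn; exists (edge_of x); rewrite !inE eqxx.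
Qed.

Lemma primitive_arrow p : primitive_vector K p -> exists x, p = arrow x.
Proof.
case: p => s u /and4P[/= /vertex_or_edge[s0 _] /vertex_or_edge[u0 [i ui]] su /eqP].
rewrite /sdim; rewrite -finset.card_gt0 in s0; rewrite -finset.card_gt0 in u0 => dim.
have uE : u = [set i; ordS i]%SET.
  by apply/eqP; rewrite finset.eqEcard ui card_edge; lia.
have s1 : #|s| = 1 by move: dim; rewrite uE card_edge; lia.
have /cards1P[z sE] : #|s| == 1 by rewrite s1.
have lt0 : (2 * i < N)%N by have := ltn_ord i; lia.
have lt1 : (2 * i + 1 < N)%N by have := ltn_ord i; lia.
have e0 : edge_of (Ordinal lt0) = i by apply: val_inj => /=; lia.
have e1 : edge_of (Ordinal lt1) = i by apply: val_inj => /=; lia.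
have : z \in [set i; ordS i]%SET by rewrite -uE; apply: (fintype.subsetP su); rewrite sE inE.
rewrite !inE sE uE => /orP[]/eqP ->.
  exists (Ordinal lt0); rewrite /arrow /tip e0 /= ifF//; lia.
exists (Ordinal lt1); rewrite /arrow /tip e1 /= ifT//; lia.
Qed.

Let N_gt0 : (0 < N)%N.
Proof. by lia. Qed.

(* The default value is only taken on pairs that are not primitive vectors. *)
Definition arrow_index (p : pair) : 'I_N :=
  odflt (Ordinal N_gt0) [pick x | arrow x == p].

Lemma arrowK : cancel arrow arrow_index.
Proof.
move=> x; rewrite /arrow_index; case: pickP => [y /eqP/arrow_inj //|/(_ x)].
by rewrite eqxx.
Qed.

Lemma arrow_simplicial :
  simplicial (flag_complex (@stage N N)) (generalized_morse_complex K) arrow.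
Proof.
move=> s /mem_flag[s0 sc]; rewrite inE; apply/and3P; split.
- by rewrite imset_eq0.
- by apply/forall_inP => _ /imsetP[x _ ->]; exact: arrow_primitive.
apply/forall_inP => u _; apply/card_le1_eqP => p q.
move=> /setIdP[/imsetP[x xs ->{p}] xu] /setIdP[/imsetP[y ys ->{q}] yu].
apply/eqP/negPn/negP => xy.
have := sc _ _ xs ys; rewrite /stage arrow_adjacent.
have -> : x != y by apply: contraNneq xy => ->.
rewrite andTb => /negP[]; apply/orP.
have c1 z : #|(arrow z).1| = 1 by rewrite cards1.
have c2 z : #|(arrow z).2| = 2 by rewrite card_edge.
case/orP: xu => /eqP xu; case/orP: yu => /eqP yu.
- by left; rewrite xu yu eqxx.
- by have := c1 x; rewrite xu -yu c2.
- by have := c1 y; rewrite yu -xu c2.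
- by right; rewrite xu yu eqxx.
Qed.

Lemma arrow_index_simplicial :
  simplicial (generalized_morse_complex K) (flag_complex (@stage N N)) arrow_index.
Proof.
move=> W; rewrite inE => /and3P[W0 /forall_inP Wp /forall_inP Wd].
apply/mem_flag; split; first by rewrite imset_eq0.
move=> _ _ /imsetP[p pW ->] /imsetP[q qW ->].
have [x px] := primitive_arrow (Wp _ pW); have [y qy] := primitive_arrow (Wp _ qW).
rewrite px qy !arrowK /stage arrow_adjacent; apply/negP => /andP[xy share].
have {share}[u uK [pu qu]] : exists2 u, u \in simplices K &
    ((p.1 == u) || (p.2 == u)) /\ ((q.1 == u) || (q.2 == u)).
  have /and4P[p1K p2K _ _] := Wp _ pW.
  case/orP: share => /eqP E; [exists p.1|exists p.2] => //;
    by rewrite px qy -E !eqxx ?orbT.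
have /card_le1_eqP pq := Wd _ uK.
have pqE : p = q by apply: pq; rewrite inE ?pW ?qW.
by move: xy; rewrite -(inj_eq arrow_inj) -px -qy pqE eqxx.
Qed.

(** Discrete vector fields are the matchings of the Hasse diagram, which is a
    cycle, and matchings of a cycle are independent sets of a cycle of the same
    length. *)
Lemma morse_cycle_stage :
  homotopy_equivalent R (realization R (generalized_morse_complex K))
    (realization R (flag_complex (@stage N N))).
Proof.
apply: (contiguity_equivalent R arrow_index_simplicial arrow_simplicial).
  move=> W WK; suff -> : (arrow @: (arrow_index @: W))%SET = W by rewrite finset.setUid.
  move: WK; rewrite inE => /and3P[_ /forall_inP Wp _].
  rewrite -imset_comp -[RHS]imset_id; apply: eq_in_imset => p pW /=.
  by have [x ->] := primitive_arrow (Wp _ pW); rewrite arrowK.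
move=> s sK; suff -> : (arrow_index @: (arrow @: s))%SET = s by rewrite finset.setUid.
by rewrite -imset_comp -[RHS]imset_id; apply: eq_imset => x /=; rewrite arrowK.
Qed.

End MorseComplexOfCycle.

(** * The homotopy type *)

Local Close Scope ring_scope.
Local Close Scope classical_set_scope.

Theorem theorem20 (R : realType) (t n : nat) (ht : (3 < t)%N) :
  let GM := realization R (generalized_morse_complex (cycle_complex t)) in
  [/\ t = (3 * n)%N ->
        homotopy_equivalent R GM
          (wedge2 (sphere R (2 * n - 1)) (sphere R (2 * n - 1))),
      t = (3 * n + 1)%N ->
        homotopy_equivalent R GM (sphere R (2 * n))
    & t = (3 * n + 2)%N ->
        homotopy_equivalent R GM (sphere R (2 * n))].
Proof.
move=> GM; have GM_stage := morse_cycle_stage R (ltnW ht).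
split=> tE; apply: homotopy_equivalent_trans GM_stage _.
- have reduce : (2 * t = 3 + 3 * (2 * n - 1))%N by lia.
  apply: homotopy_equivalent_trans (stage_reduce R (isT : 0 < 3)%N reduce) _.
  have blocks : (2 * t = 3 * (2 * n - 1).+1)%N by lia.
  apply: homotopy_equivalent_trans (stage_doubled R blocks) _.
  apply: homotopy_equivalent_trans (doubled_sided R _) _.
  apply: homotopy_equivalent_trans (sided_glued R _) _.
  exact: glued_wedge.
- have reduce : (2 * t = 2 + 3 * (2 * n))%N by lia.
  apply: homotopy_equivalent_trans (stage_reduce R (isT : 0 < 2)%N reduce) _.
  apply: homotopy_equivalent_trans (cross_sphere R (2 * n)).
  by apply: stage_cross; lia.
- have reduce : (2 * t = 1 + 3 * (2 * n + 1))%N by lia.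
  apply: homotopy_equivalent_trans (stage_reduce R (isT : 0 < 1)%N reduce) _.
  apply: homotopy_equivalent_trans (cross_sphere R (2 * n)).
  by apply: stage_cross; lia.
Qed.
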